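(* Let $K$ be a field, let $n\ge 1$ and $s\ge 1$ be integers, let $R=K[X_1,\dots,X_n]$ be the polynomial ring with the standard grading $\deg X_i=1$ for $i=1,\dots,n$, and let $\mathfrak m=(X_1,\dots,X_n)$. Then the Hilbert depth of the graded $R$-module $\mathfrak m^s$ (the $s$-th power of the ideal $\mathfrak m$) is $$\operatorname{Hdepth}\mathfrak m^s=\left\lceil \frac{n}{s+1}\right\rceil .$$
   Context: For a finitely generated graded $R$-module $M=\bigoplus_{k\in\mathbb Z}M_k$, the Hilbert series of $M$ is the Laurent series $H_M(T)=\sum_{k\in\mathbb Z}(\dim_K M_k)\,T^k$. For $M\neq 0$ the Hilbert depth of $M$ is $$\operatorname{Hdepth} M=\max\{\operatorname{depth} N : N \text{ a finitely generated graded } R\text{-module with } H_N(T)=H_M(T)\},$$ where $\operatorname{depth} N$ is the depth of $N$ with respect to the maximal ideal $\mathfrak m=(X_1,\dots,X_n)$, i.e. the maximal length of an $N$-regular sequence in $\mathfrak m$. *)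

(* Defs.v *)
From HB Require Import structures.
From mathcomp Require Import all_boot all_order all_algebra.
From mathcomp Require Import boolp classical_sets.
From mathcomp Require Import mpoly.

Set Implicit Arguments.
Unset Strict Implicit.
Unset Printing Implicit Defensive.

Import GRing.Theory.
Local Open Scope ring_scope.
Local Open Scope classical_set_scope.

Definition is_max (P : set nat) (d : nat) : Prop :=
  P d /\ forall e, P e -> (e <= d)%N.

Section Ideals.
Variable R : comNzRingType.

Definition ideal_gen (A : set R) : set R :=
  [set p | exists2 c : seq (R * R), (forall x, x \in c -> A x.2)
                                  & p = \sum_(x <- c) x.1 * x.2].

(* For s = 0 the only generator is the empty product 1. *)
Definition ideal_pow (I : set R) (s : nat) : set R :=
  ideal_gen [set p | exists2 t : seq R, size t = s /\ (forall x, x \in t -> I x)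
                                      & p = \prod_(x <- t) x].

Definition ideal_pow_pred (I : set R) (s : nat) : {pred R^o} :=
  fun p => `[< ideal_pow I s p >].

Lemma ideal_gen0 A : ideal_gen A 0.
Proof. by exists [::]; rewrite ?big_nil. Qed.

Lemma ideal_genD A p q : ideal_gen A p -> ideal_gen A q -> ideal_gen A (p + q).
Proof.
move=> [c hc ->] [d hd ->]; exists (c ++ d); last by rewrite big_cat.
by move=> x; rewrite mem_cat => /orP[/hc|/hd].
Qed.

Lemma ideal_genM A a p : ideal_gen A p -> ideal_gen A (a * p).
Proof.
move=> [c hc ->]; exists [seq (a * x.1, x.2) | x <- c].
  by move=> _ /mapP[x /hc hx ->].
by rewrite big_map mulr_sumr; apply: eq_bigr => x _; rewrite mulrA.
Qed.

Lemma ideal_gen_sub (A : set R) p : A p -> ideal_gen A p.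
Proof.
move=> Ap; exists [:: (1, p)]; last by rewrite big_seq1 mul1r.
by move=> x; rewrite inE => /eqP ->.
Qed.

Lemma ideal_pow_submod_closed I s : submod_closed (ideal_pow_pred I s).
Proof.
split; first exact/asboolP/ideal_gen0.
move=> a p q /asboolP hp /asboolP hq; apply/asboolP.
by apply: ideal_genD => //; exact: ideal_genM.
Qed.

HB.instance Definition _ I s :=
  GRing.isSubmodClosed.Build R R^o (ideal_pow_pred I s)
    (ideal_pow_submod_closed I s).

Record ideal_pow_type (I : set R) (s : nat) : Type := IdealPow {
  ideal_pow_val : R^o;
  _ : ideal_pow_val \in ideal_pow_pred I s }.

HB.instance Definition _ I s := [isSub for @ideal_pow_val I s].
HB.instance Definition _ I s := [Choice of ideal_pow_type I s by <:].
HB.instance Definition _ I s :=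
  [SubChoice_isSubLmodule of ideal_pow_type I s by <:].

End Ideals.

Section GradedModules.
Variables (K : fieldType) (n : nat).

Definition max_ideal : set {mpoly K[n]} :=
  ideal_gen [set p | exists i : 'I_n, p = 'X_i].

Record gradedModule := GradedModule {
  gr_sort :> lmodType {mpoly K[n]};
  gr_comp : int -> set gr_sort;
  gr_comp0 : forall k, gr_comp k 0;
  gr_compB : forall k u v, gr_comp k u -> gr_comp k v -> gr_comp k (u - v);
  gr_compZ : forall d k (p : {mpoly K[n]}) v,
    p \is d.-homog -> gr_comp k v -> gr_comp (d%:Z + k) (p *: v);
  gr_span : forall v, exists (I : seq int) (f : int -> gr_sort),
    (forall k, gr_comp k (f k)) /\ v = \sum_(k <- I) f k;
  gr_direct : forall (I : seq int) (f : int -> gr_sort),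
    uniq I -> (forall k, gr_comp k (f k)) -> \sum_(k <- I) f k = 0 ->
    forall k, k \in I -> f k = 0 }.

Definition fin_gen (N : lmodType {mpoly K[n]}) : Prop :=
  exists g : seq N, forall v, exists c : nat -> {mpoly K[n]},
    v = \sum_(i < size g) c i *: g`_i.

(* K acts on an R-module through the constant polynomials c%:MP. *)
Definition is_Kbasis (N : lmodType {mpoly K[n]}) (V : set N) (b : seq N) : Prop :=
  [/\ forall v, v \in b -> V v,
      forall c : nat -> K, \sum_(i < size b) (c i)%:MP *: b`_i = 0 ->
        forall i, (i < size b)%N -> c i = 0
    & forall v, V v ->
        exists c : nat -> K, v = \sum_(i < size b) (c i)%:MP *: b`_i].

(* The value is 0 by convention when V has no finite basis; this never occurs
   for a homogeneous component of a finitely generated graded module. *)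
Definition dimK (N : lmodType {mpoly K[n]}) (V : set N) : nat :=
  xget 0%N [set d | exists2 b : seq N, size b = d & is_Kbasis V b].

(* A Laurent series is represented by its coefficient function. *)
Definition hilbert_series (N : gradedModule) : int -> nat :=
  fun k => dimK (@gr_comp N k).

(* The submodule (x_1, ..., x_r) N. *)
Definition seq_submod (N : lmodType {mpoly K[n]}) (xs : seq {mpoly K[n]}) : set N :=
  [set v | exists u : nat -> N, v = \sum_(i < size xs) xs`_i *: u i].

Definition regular_seq (N : lmodType {mpoly K[n]}) (xs : seq {mpoly K[n]}) : Prop :=
  (forall i, (i < size xs)%N -> forall v : N,
     seq_submod (take i xs) (xs`_i *: v) -> seq_submod (take i xs) v)
  /\ exists v : N, ~ seq_submod xs v.

Definition is_depth (N : lmodType {mpoly K[n]}) : nat -> Prop :=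
  is_max [set l | exists xs : seq {mpoly K[n]},
    [/\ size xs = l, forall x, x \in xs -> max_ideal x & regular_seq N xs]].

(* No d satisfies is_Hdepth M d when M = 0, as the zero module has no regular
   sequence, not even the empty one. *)
Definition is_Hdepth (M : gradedModule) : nat -> Prop :=
  is_max [set d | exists N : gradedModule,
    [/\ fin_gen N, hilbert_series N = hilbert_series M & is_depth N d]].

Section PowerOfMaxIdeal.
Variable s : nat.

Let T : lmodType {mpoly K[n]} := ideal_pow_type max_ideal s.

Definition pval (v : T) : {mpoly K[n]} := ideal_pow_val v.

Arguments pval : simpl never.

Lemma pval0 : pval 0 = 0.
Proof. by []. Qed.

Lemma pvalB u v : pval (u - v) = pval u - pval v.
Proof. exact: (raddfB (val : T -> {mpoly K[n]}^o)). Qed.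

Lemma pvalZ p v : pval (p *: v) = p * pval v.
Proof. by []. Qed.

Lemma pval_sum (I : seq int) (f : int -> T) :
  pval (\sum_(k <- I) f k) = \sum_(k <- I) pval (f k).
Proof. exact: (raddf_sum (val : T -> {mpoly K[n]}^o)). Qed.

Lemma pvalP v : ideal_pow max_ideal s (pval v).
Proof. by apply/asboolP; exact: (valP v). Qed.

Lemma pval_inj : injective pval.
Proof. exact: val_inj. Qed.

Definition max_pow_comp (k : int) : set T :=
  [set v | match k with
           | Posz d => pval v \is d.-homog
           | Negz _ => pval v = 0
           end].

Lemma max_pow_comp0 k : max_pow_comp k 0.
Proof. by case: k => d; rewrite /max_pow_comp /= pval0 ?dhomog0. Qed.

Lemma max_pow_compB k u v :
  max_pow_comp k u -> max_pow_comp k v -> max_pow_comp k (u - v).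
Proof.
case: k => d; rewrite /max_pow_comp /= pvalB; first exact: rpredB.
by move=> -> ->; rewrite subr0.
Qed.

Lemma max_pow_compZ d k (p : {mpoly K[n]}) v :
  p \is d.-homog -> max_pow_comp k v -> max_pow_comp (d%:Z + k) (p *: v).
Proof.
move=> hp; rewrite /max_pow_comp /= pvalZ.
case: k => e hv; first by rewrite -PoszD; exact: dhomogM.
rewrite hv mulr0; case: (_ + _) => // m; exact: dhomog0.
Qed.

Definition low_free (s : nat) (p : {mpoly K[n]}) :=
  forall m : 'X_{1.. n}, (mdeg m < s)%N -> p@_m = 0.

Lemma low_freeM a b (p q : {mpoly K[n]}) :
  low_free a p -> low_free b q -> low_free (a + b) (p * q).
Proof.
move=> hp hq m hm; rewrite mcoeffM big1 // => -[u v] /= /eqP e.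
have huv : (mdeg u + mdeg v < a + b)%N by rewrite -mdegD -e.
case: (ltnP (mdeg u) a) => hu; first by rewrite hp // mul0r.
rewrite (hq v) ?mulr0 // -(ltn_add2l a); apply: leq_ltn_trans huv.
by rewrite leq_add2r.
Qed.

Lemma low_free_gen e (A : set {mpoly K[n]}) p :
  (forall q, A q -> low_free e q) -> ideal_gen A p -> low_free e p.
Proof.
move=> hA [c hc ->] m hm; rewrite raddf_sum /= big_seq big1 // => x /hc hx.
by apply: (@low_freeM 0 e) => //; apply: hA.
Qed.

Lemma max_pow_low_free p : ideal_pow max_ideal s p -> low_free s p.
Proof.
apply: low_free_gen => _ [t [<- ht] ->].
elim: t ht => [|x t IH] ht; first by [].
rewrite big_cons /=; apply: (@low_freeM 1 (size t)); last first.
  by apply: IH => y yt; apply: ht; rewrite inE yt orbT.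
have : max_ideal x by apply: ht; rewrite mem_head.
apply: low_free_gen => _ [i ->] m; rewrite ltnS leqn0 mdeg_eq0 => /eqP ->.
by rewrite mcoeffX mnm1_eq0.
Qed.

Lemma mnm_prod e (m : 'X_{1.. n}) : (e <= mdeg m)%N ->
  exists (t : seq {mpoly K[n]}) (m' : 'X_{1.. n}),
    [/\ size t = e, forall x, x \in t -> max_ideal x
      & 'X_[m] = 'X_[m'] * \prod_(x <- t) x].
Proof.
elim: e m => [|e IH] m hm; first by exists [::], m; rewrite big_nil mulr1.
have /existsP[i hi] : [exists i, m i != 0%N].
  apply/existsP; apply/not_existsP => h; move: hm; rewrite mdegE big1 // => i _.
  by apply/eqP/negPn/negP/h.
have le : (U_(i) <= m)%MM by rewrite lep1mP.
have [|t [m' [st ht e']]] := IH (m - U_(i))%MM.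
  by rewrite -ltnS; move: hm; rewrite -{1}(submK le) mdegD mdeg1 addn1.
exists ('X_i :: t), m'; split; first by rewrite /= st.
  move=> x; rewrite inE => /orP[/eqP ->|]; last exact: ht.
  by apply: ideal_gen_sub; exists i.
by rewrite big_cons mulrCA -e' -mpolyXD addmC submK.
Qed.

Lemma low_free_max_pow p : low_free s p -> ideal_pow max_ideal s p.
Proof.
move=> hp; rewrite (mpolyE p) big_seq.
apply: (big_ind (ideal_pow max_ideal s)).
- exact: ideal_gen0.
- by move=> x y; apply: ideal_genD.
move=> m; rewrite mcoeff_msupp => hm.
have [|t [m' [st ht ->]]] := @mnm_prod s m.
  by rewrite leqNgt; apply: contra hm => /hp ->.
rewrite -mul_mpolyC mulrA; apply: ideal_genM; apply: ideal_gen_sub.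
by exists t.
Qed.

Lemma max_pow_pihomog d p :
  ideal_pow max_ideal s p -> ideal_pow max_ideal s (pihomog mdeg d p).
Proof.
move=> /max_pow_low_free hp; apply: low_free_max_pow => m hm.
have [e|ne] := eqVneq (mdeg m) d; last first.
  exact: (dhomog_nemf_coeff (pihomogP _ _ _) ne).
rewrite pihomogE raddf_sum /= big1 // => m' /eqP hm'.
rewrite mcoeffZ mcoeffX; case: eqP => [->|]; last by rewrite mulr0.
by rewrite hp // mul0r.
Qed.

Lemma max_pow_span (v : T) : exists (I : seq int) (f : int -> T),
  (forall k, max_pow_comp k (f k)) /\ v = \sum_(k <- I) f k.
Proof.
have hv d : (pihomog mdeg d (pval v) : {mpoly K[n]}^o)
    \in ideal_pow_pred max_ideal s.
  by apply/asboolP; apply: max_pow_pihomog; exact: pvalP.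
pose f (k : int) : T := if k is Posz d then IdealPow (hv d) else 0.
exists [seq Posz d | d <- iota 0 (mmeasure mdeg (pval v))], f; split.
  case=> d; last by rewrite /max_pow_comp /= pval0.
  by rewrite /max_pow_comp /=; exact: pihomogP.
apply: pval_inj; rewrite pval_sum big_map.
rewrite {1}(@pihomog_partitionE _ _ mdeg _ (pval v) (leqnn _)).
by rewrite -(big_mkord xpredT (fun d => pihomog mdeg d (pval v))) /index_iota subn0.
Qed.

Lemma max_pow_direct (I : seq int) (f : int -> T) :
  uniq I -> (forall k, max_pow_comp k (f k)) -> \sum_(k <- I) f k = 0 ->
  forall k, k \in I -> f k = 0.
Proof.
move=> uI hf /(congr1 pval); rewrite pval_sum pval0 => h0 k kI.
apply: pval_inj; rewrite pval0; have := hf k.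
case: k kI => d kI; rewrite /max_pow_comp //= => hd.
have := congr1 (pihomog mdeg d) h0; rewrite pihomog0 raddf_sum.
rewrite (bigD1_seq _ kI uI) /= (pihomog_dE hd) big1 ?addr0 //.
move=> [e|e] ne; last first.
  by have := hf (Negz e); rewrite /max_pow_comp /= => ->; rewrite pihomog0.
have := hf (Posz e); rewrite /max_pow_comp /=; apply: pihomog_ne0.
by apply: contra ne => /eqP ->.
Qed.

Definition max_pow : gradedModule :=
  GradedModule max_pow_comp0 max_pow_compB max_pow_compZ
               max_pow_span max_pow_direct.

End PowerOfMaxIdeal.
End GradedModules.

Arguments max_pow K n s : clear implicits.

(* Main.v *)
Require Import Defs.
From HB Require Import structures.
From mathcomp Require Import all_boot all_order all_algebra.
From mathcomp Require Import boolp classical_sets functions generic_quotient.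
From mathcomp Require Import zify ring mpoly.

(** Upper bound.  Let N have the Hilbert series of m^s and let x_1, ..., x_e in m
    be N-regular.  Over N[Y] put z = X_1 + X_2 Y + ... + X_n Y^(n-1).  If some
    element of m is regular on a module M, then z is regular on M[Y] (McCoy), and
    hence x_1, ..., x_(e-1) is regular on N[Y]/z N[Y].  Iterating with fresh
    variables gives e generic linear forms that form a regular sequence; in the
    lowest degree s they map (N_s)^e injectively to N_(s+1), so that
    e dim N_s <= dim N_(s+1), which says e (s + 1) <= n + s.  Genericity replaces
    prime avoidance, so that K may be finite and the x_i inhomogeneous.

    Lower bound.  Let d = ceil(n / (s + 1)).  The coefficients of
    (1 - T)^d H(T) for H the Hilbert series of m^s are nonnegative, and from
    degree s + d on they agree with the Hilbert function of a polynomial ring in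
    n - d variables.  Hence H is a finite sum of Hilbert series of shifted
    polynomial rings K[X_1, ..., X_i](-a) with d <= i <= n, and X_1, ..., X_d is
    regular on the direct sum of these modules. *)

Set Implicit Arguments.
Unset Strict Implicit.
Unset Printing Implicit Defensive.

Import GRing.Theory Order.TTheory Num.Theory.

(** * Binomial inequalities and Hilbert functions *)

Section Binomial.

Lemma sum_bin_col q p : \sum_(i < q.+1) 'C(i, p) = 'C(q.+1, p.+1).
Proof.
elim: q => [|q IH]; first by rewrite big_ord_recr big_ord0 binS; case: p.
by rewrite big_ord_recr /= IH -binS.
Qed.

(** Summation by parts: 'C(t + m + i, t) is the difference of two consecutive binomials with lower
    index t + 1. All terms are moved so that no subtraction occurs. *)
Lemma sum_mul_bin q m t :
  \sum_(i < q.+1) i * 'C(t + m + i, t) + 'C(m + q + t.+1, t.+2) =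
  q * 'C(m + q + t.+1, t.+1) + 'C(m + t.+1, t.+2).
Proof.
elim: q => [|q IH]; first by rewrite big_ord_recr big_ord0 /= !addn0 mul0n.
rewrite big_ord_recr /= (_ : m + q.+1 + t.+1 = (m + q + t.+1).+1) ?binS; last lia.
rewrite (_ : t + m + q.+1 = m + q + t.+1); last lia.
move: IH; set S := \sum_(i < _) _; lia.
Qed.

(** Up to the sign (-1)^p, this is the contribution of the sum in [cnt_unroll] to the coefficient of
    T^(t + 1 + p) in (1 - T)^(q + 1) H(T). *)
Definition wsum q m t p := \sum_(i < q.+1) 'C(i, p) * 'C(t + m + i, t).

(** By [sum_mul_bin] it suffices that q 'C(M, t + 1) <= 'C(M, t + 2). The quotient of these two
    binomials is (m + q) / (t + 2), which is at least q exactly when (t + 1) q <= m. *)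
Lemma wsum1_le q m t : t.+1 * q <= m -> wsum q m t 1 <= 'C(m + t.+1, t.+2).
Proof.
move=> h; have := sum_mul_bin q m t; rewrite /wsum.
under [in X in _ -> X]eq_bigr => i _ do rewrite bin1.
set S := \sum_(i < _) _; set M := m + q + t.+1.
suff : q * 'C(M, t.+1) <= 'C(M, t.+2) by lia.
have := mul_bin_left M t.+1; rewrite (_ : M - t.+1 = m + q); last by rewrite /M; lia.
move: 'C(M, t.+1) 'C(M, t.+2) => x y e.
rewrite -(leq_pmul2l (ltn0Sn t.+1)) e mulnA leq_mul2r; apply/orP; right; nia.
Qed.

Lemma wsumS_le q m t p : p.+1 * wsum q m t p.+1 <= (q - p) * wsum q m t p.
Proof.
rewrite /wsum !big_distrr /=; apply: leq_sum => i _; rewrite !mulnA mul_bin_left.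
by rewrite leq_mul2r leq_mul2r leq_sub2r ?orbT // -ltnS.
Qed.

(** Induction on p: from p to p + 1 the left side grows at most by the factor (q - p) / (p + 1), the
    right side by (m + t + p + 1) / (t + p + 2). Comparing these factors can fail for t = 0, where
    the hockey-stick identity gives the sum in closed form instead. *)
Lemma wsum_le q m t p : t.+1 * q <= m -> 0 < p -> wsum q m t p <= 'C(m + t + p, t.+1 + p).
Proof.
move=> h; case: p => // p _; case: t h => [|t] h.
  rewrite /wsum; under eq_bigr => i _ do rewrite bin0 muln1.
  rewrite sum_bin_col add1n addn0.
  have [->|q0] := posnP q; first by rewrite bin_small.
  by apply: leq_bin2l; lia.
elim: p => [|p IH]; first by have := wsum1_le h; rewrite addn1 addnS addn1.
have h1 := wsumS_le q m t.+1 p.+1.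
have h2 := mul_bin_diag (m + t.+1 + p.+2) (t.+2 + p.+1).
rewrite (_ : (m + t.+1 + p.+2).-1 = m + t.+1 + p.+1) in h2; last lia.
rewrite (_ : (t.+2 + p.+1).+1 = t.+2 + p.+2) in h2; last lia.
have h3 : (q - p.+1) * (t.+2 + p.+2) <= (m + t.+1 + p.+2) * p.+2 by nia.
move: h1 h2 IH; set A1 := wsum _ _ _ p.+1; set A2 := wsum _ _ _ p.+2.
set B1 := 'C(_, t.+2 + p.+1); set B2 := 'C(_, t.+2 + p.+2) => h1 h2 IH.
rewrite -(@leq_pmul2l (p.+2 * (t.+2 + p.+2))) // -[_ * _ * B2]mulnA -h2.
rewrite mulnAC (leq_trans (leq_mul h1 (leqnn _))) // mulnAC.
by rewrite (leq_trans (leq_mul h3 IH)) // mulnA [_ * p.+2]mulnC.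
Qed.

End Binomial.

(** * Hilbert functions of shifted polynomial rings and the expansion of H *)

Section HilbertFunctions.

(* The number of monomials of degree k in i variables, also for i = 0. *)
Definition cnt i k := 'C((k + i).-1, k).

Lemma cntS i k : cnt i.+1 k.+1 = cnt i k.+1 + cnt i.+1 k.
Proof. by rewrite /cnt !addnS !addSn /= binS. Qed.

Lemma cnt0n k : cnt 0 k = (k == 0).
Proof. by case: k => // k; rewrite /cnt addn0 bin_small. Qed.

(* The Hilbert function of K[X_1, ..., X_i](-a). *)
Definition scnt i k a := if a <= k then cnt i (k - a) else 0.

Lemma scnt_gt i k a : k < a -> scnt i k a = 0.
Proof. by move=> h; rewrite /scnt leqNgt h. Qed.

Lemma scntSS i k a : scnt i k.+1 a.+1 = scnt i k a.
Proof. by []. Qed.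

Lemma scnt0n k a : scnt 0 k a = (a == k).
Proof. by rewrite /scnt cnt0n subn_eq0 eqn_leq; case: (a <= k). Qed.

Lemma scntSk i k a : scnt i.+1 k.+1 a = scnt i k.+1 a + scnt i.+1 k a.
Proof.
have [ak|ka] := leqP a k; first by rewrite /scnt ak leqW // subSn // cntS.
rewrite (scnt_gt _ ka) addn0; have [e|ne] := eqVneq a k.+1.
  by rewrite e /scnt leqnn subnn /cnt !bin0.
by rewrite !scnt_gt // ltn_neqAle eq_sym ne.
Qed.

(** The exact sequence 0 -> S(-a - 1) -> S(-a) -> (S/xS)(-a) -> 0 for a variable x of S. *)
Lemma scntS i k a : scnt i.+1 k a = scnt i k a + scnt i.+1 k a.+1.
Proof.
case: k => [|k]; last by rewrite scntSk scntSS.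
by rewrite (scnt_gt _ (ltn0Sn a)) addn0; case: a => [|a] //; rewrite /scnt /cnt !bin0.
Qed.

(* Monomials in m + d variables whose degree in the first m is at least D. *)
Definition gcnt d m D k := \sum_(D <= r < k.+1) cnt m r * scnt d k r.

Lemma gcntD d m D k : gcnt d m D k = cnt m D * scnt d k D + gcnt d m D.+1 k.
Proof.
rewrite /gcnt; have [Dk|kD] := leqP D k; first by rewrite big_ltn.
by rewrite scnt_gt // muln0 !big_geq // ltnW.
Qed.

Lemma gcntDn d m D k e : gcnt d m D k =
  \sum_(p < e) cnt m (D + p) * scnt d k (D + p) + gcnt d m (D + e) k.
Proof.
elim: e => [|e IH]; first by rewrite big_ord0 addn0.
by rewrite IH big_ord_recr /= [gcnt _ _ (D + e) _]gcntD addnA addnS.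
Qed.

(** The monomials are sorted by divisibility by one of the first m + 1 variables; dividing by it
    lowers both the degree and the bound on the partial degree. *)
Lemma gcntSS d m D k : gcnt d m.+1 D.+1 k =
  gcnt d m D.+1 k + (if k is k'.+1 then gcnt d m.+1 D k' else 0).
Proof.
case: k => [|k]; first by rewrite /gcnt !big_geq.
rewrite /gcnt !big_add1 /= -big_split; apply: eq_bigr => r _.
by rewrite cntS mulnDl scntSS.
Qed.

Lemma gcntS0 d m k : gcnt d m.+1 0 k =
  gcnt d m 0 k + (if k is k'.+1 then gcnt d m.+1 0 k' else 0).
Proof. by rewrite !(gcntD _ _ 0) gcntSS addnA /cnt !bin0. Qed.

Lemma gcnt0 d m k : gcnt d m 0 k = cnt (m + d) k.
Proof.
elim: m k => [|m IHm] k.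
  rewrite gcntD cnt0n mul1n /gcnt big_nat big1 ?addn0 => [|r /andP[r0 _]].
    by rewrite /scnt subn0.
  by rewrite cnt0n eqn0Ngt r0.
elim: k => [|k IHk]; first by rewrite gcntS0 addn0 IHm /cnt !bin0.
by rewrite gcntS0 IHm IHk addSn cntS.
Qed.

(** Write a monomial as a nondecreasing word in the variables and look at its letter number t + 1.
    If it is among the first m variables, the monomial is counted by [gcnt]. If it is the variable
    number m + i + 1, then t letters from the first m + i + 1 variables precede it, and any monomial
    in the last d - i variables may follow. The formal proof is a double induction on d and k. *)
Lemma cnt_unroll d m t k : (if t.+1 <= k then cnt (m + d) k else 0) =
  gcnt d m t.+1 k + \sum_(i < d) cnt (m + i.+1) t * scnt (d - i) k t.+1.
Proof.
elim: d k => [|d IHd] k.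
  rewrite big_ord0 !addn0 /gcnt; have [tk|kt] := leqP t.+1 k; last by rewrite big_geq.
  rewrite big_nat_recr //= scnt0n eqxx muln1 big_nat big1 // => r /andP[_ rk].
  by rewrite scnt0n ltn_eqF // muln0.
elim: k => [|k IHk].
  rewrite ltn0 /gcnt big_geq // big1 // => i _.
  by rewrite scnt_gt // muln0.
have -> : gcnt d.+1 m t.+1 k.+1 = gcnt d m t.+1 k.+1 + gcnt d.+1 m t.+1 k.
  rewrite /gcnt; have [tk|kt] := leqP t.+1 k.+1; last by rewrite !big_geq // ltnW.
  rewrite (big_nat_recr k.+1 t.+1 (fun r => cnt m r * scnt d.+1 k.+1 r)) //=.
  rewrite (big_nat_recr k.+1 t.+1 (fun r => cnt m r * scnt d k.+1 r)) //=.
  rewrite addnAC -big_split /= /scnt leqnn subnn /cnt !bin0 -/(scnt _ _ _).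
  congr (_ + _); apply: eq_big_nat => r _.
  by rewrite -!/(scnt _ _ _) scntSk mulnDr.
have -> : \sum_(i < d.+1) cnt (m + i.+1) t * scnt (d.+1 - i) k.+1 t.+1 =
    \sum_(i < d.+1) cnt (m + i.+1) t * scnt (d - i) k.+1 t.+1 +
    \sum_(i < d.+1) cnt (m + i.+1) t * scnt (d.+1 - i) k t.+1.
  rewrite -big_split; apply: eq_bigr => i _ /=.
  by rewrite subSn ?scntSk ?mulnDr // -ltnS.
(* The term i = d involves a polynomial ring in no variables, so it contributes only for k = t,
   exactly where the left side jumps from 0. *)
rewrite [X in _ = _ + (X + _)]big_ord_recr /= subnn scnt0n eqSS.
move: IHk (IHd k.+1); rewrite addnS cntS ltnS.
set S1 := \sum_(i < d) _; set S2 := \sum_(i < d.+1) _ => IHk IHd1.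
rewrite [RHS](_ : _ = (gcnt d m t.+1 k.+1 + S1) + (gcnt d.+1 m t.+1 k + S2) +
  cnt (m + d).+1 t * (t == k)); last lia.
rewrite -IHk -IHd1; case: ltngtP => [_|_|->]; lia.
Qed.

(** Coefficient form of T^a / (1 - T)^d = (1 - T)^i T^a / (1 - T)^(d + i). The free bound P lets all
    values of i share one summation range in [cnt_expansion]. *)
Lemma scnt_sub i d k a P : i < P ->
  (scnt d k a : int) =
  (\sum_(p < P) (-1) ^+ p * 'C(i, p)%:Z * (scnt (d + i) k (a + p))%:Z)%R.
Proof.
elim: i P d => [|i IH] P d iP.
  case: P iP => // P _; rewrite big_ord_recl big1 /= => [|p _].
    by rewrite !addn0 expr0 bin0 !mul1r addr0.
  by rewrite bin0n mulr0 mul0r.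
rewrite (IH P) ?(ltn_trans _ iP) //.
pose X p := Posz (scnt (d + i.+1) k (a + p)).
have XE p : Posz (scnt (d + i) k (a + p)) = (X p - X p.+1)%R.
  by rewrite /X !addnS scntS PoszD addrK.
under eq_bigr => p _ do rewrite XE mulrBr.
rewrite sumrB; case: P iP => // P; rewrite ltnS => iP.
rewrite [X in (_ - X)%R]big_ord_recr /= (bin_small iP) mulr0 mul0r addr0.
rewrite big_ord_recl [RHS]big_ord_recl /= !bin0 -addrA; congr (_ + _)%R.
rewrite -sumrB; apply: eq_bigr => p _; rewrite /bump /= add1n binS PoszD -/(X _).
by rewrite exprS /X; ring.
Qed.

Definition wcoef q m t p :=
  if odd p then cnt m (t.+1 + p) - wsum q m t p else cnt m (t.+1 + p) + wsum q m t p.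

(* Here s = t + 1, d = q + 1 and n = m + d, and wcoef q m t p is the coefficient
   of T^(s + p) in (1 - T)^d H(T); the hypothesis makes the truncated subtraction
   in wcoef exact. *)
Lemma cnt_expansion q m t k : t.+1 * q <= m ->
  (if t.+1 <= k then cnt (m + q.+1) k else 0) =
  gcnt q.+1 m (t.+1 + q.+1) k +
  \sum_(p < q.+1) wcoef q m t p * scnt q.+1 k (t.+1 + p).
Proof.
(* The layers of degree t + 1, ..., t + 1 + q in the first m variables are split off from [gcnt];
   they already have the shape of the terms on the right. *)
move=> h; rewrite cnt_unroll (gcntDn _ _ _ _ q.+1) addnAC addnC; congr (_ + _).
apply/eqP; rewrite -eqz_nat !PoszD !raddf_sum /=; apply/eqP.
have e (i : 'I_q.+1) : Posz (cnt (m + i.+1) t * scnt (q.+1 - i) k t.+1) =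
    (\sum_(p < q.+1) (-1) ^+ p * ('C(i, p) * 'C(t + m + i, t))%:Z *
      (scnt q.+1 k (t.+1 + p))%:Z)%R.
  rewrite PoszM (@scnt_sub i _ _ _ q.+1) // subnK; last by rewrite ltnW.
  rewrite mulr_sumr; apply: eq_bigr => p _.
  by rewrite /cnt addnA addnS /= !PoszM; ring.
under [X in (_ + X)%R]eq_bigr => i _ do rewrite e.
rewrite exchange_big -big_split; apply: eq_bigr => p _ /=.
rewrite -mulr_suml -mulr_sumr PoszM -mulrDl PoszM; congr (_ * _)%R.
rewrite -(raddf_sum Posz) -/(wsum q m t p) /wcoef -signr_odd.
case: ifP => op; last by rewrite expr0 mul1r PoszD.
rewrite expr1 mulN1r subzn // /cnt (_ : (t.+1 + p + m).-1 = m + t + p); last lia.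
(* An odd p is positive, as [wsum_le] requires. *)
by apply: wsum_le => //; case: (val p) op.
Qed.

End HilbertFunctions.

Local Open Scope ring_scope.
Local Open Scope classical_set_scope.

(** * Generic linear forms *)

Lemma fraction_denom (A : idomainType) (x : {fraction A}) :
  exists a b : A, b != 0 /\ x * tofrac b = tofrac a.
Proof.
elim/quotW: x => x; exists (frac x).1, (frac x).2; split; first exact: denom_ratioP.
apply/eqP; rewrite -[_ * _]/(FracField.mul _ _) !piE /FracField.equivf /FracField.mulf /=.
rewrite !numden_Ratio ?mulf_neq0 ?denom_ratioP ?oner_neq0 //.
by rewrite !mulr1 mulrC.
Qed.

(** If q < p, there is a nonzero kernel vector over the fraction field; clearing denominators gives
    one over A. *)
Lemma row_inj_leq (A : idomainType) (p q : nat) (B : 'M[A]_(p, q)) :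
  (forall c : 'rV_p, c *m B = 0 -> c = 0) -> (p <= q)%N.
Proof.
move=> injB; rewrite leqNgt; apply/negP => ltqp.
set BF := map_mx (@tofrac A) B.
have /rowV0Pn[v /sub_kermxP vB0 /rV0Pn[j0 vj0]] : kermx BF != 0.
  rewrite -mxrank_eq0 mxrank_ker subn_eq0 -ltnNge.
  exact: leq_ltn_trans (rank_leq_col _) ltqp.
have /choice[ab habP] : forall j, exists ab : A * A, ab.2 != 0 /\
    v 0 j * tofrac ab.2 = tofrac ab.1.
  by move=> j; have [a [b hab]] := fraction_denom (v 0 j); exists (a, b).
pose D := \prod_j (ab j).2.
have D0 : D != 0 by apply/prodf_neq0 => j _; case: (habP j).
pose c : 'rV[A]_p := \row_j ((ab j).1 * \prod_(k | k != j) (ab k).2).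
have cE : map_mx (@tofrac A) c = tofrac D *: v.
  have DE j : D = (ab j).2 * \prod_(k | k != j) (ab k).2 by rewrite /D (bigD1 j).
  by apply/rowP => j; rewrite !mxE tofracM -(habP j).2 -mulrA -tofracM -DE mulrC.
have c0 : c = 0.
  apply: injB; apply/rowP => j; apply/eqP; rewrite [in X in _ == X]mxE -tofrac_eq0.
  have : map_mx (@tofrac A) (c *m B) = 0.
    by rewrite map_mxM cE -scalemxAl vB0 scaler0.
  by move/rowP/(_ j)/eqP; rewrite !mxE.
move/rowP: cE => /(_ j0); rewrite c0 map_mx0 !mxE => /esym/eqP.
by rewrite mulf_eq0 tofrac_eq0 (negPf D0) (negPf vj0).
Qed.

(** * Regular sequences on subquotients and on their polynomial extensions *)

Section Subquotients.
Variable R : comNzRingType.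
Implicit Type E : lmodType R.

(** Quotients P / L are kept as pairs of sets in one ambient module, so that no quotient type has to
    be formed. *)
Definition submodule E (L : set E) :=
  L 0 /\ forall a u v, L u -> L v -> L (a *: u + v).

Section SubmoduleTheory.
Variables (E : lmodType R) (L : set E).
Hypothesis hL : submodule L.

Lemma submodule0 : L 0. Proof. exact: hL.1. Qed.

Lemma submoduleD u v : L u -> L v -> L (u + v).
Proof. by move=> hu hv; rewrite -[u]scale1r; apply: hL.2. Qed.

Lemma submoduleZ a u : L u -> L (a *: u).
Proof. by move=> hu; rewrite -[_ *: _]addr0; apply: hL.2 => //; exact: hL.1. Qed.

Lemma submoduleN u : L u -> L (- u).
Proof. by move=> hu; rewrite -scaleN1r; exact: submoduleZ. Qed.

Lemma submoduleB u v : L u -> L v -> L (u - v).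
Proof. by move=> hu hv; apply: submoduleD => //; exact: submoduleN. Qed.

Lemma submodule_sum I (r : seq I) (Q : pred I) (F : I -> E) :
  (forall i, Q i -> L (F i)) -> L (\sum_(i <- r | Q i) F i).
Proof. by move=> hF; apply: (big_ind L) => //; [exact: submodule0 | exact: submoduleD]. Qed.

Lemma submodule_addr u v : L u -> L (u + v) -> L v.
Proof. by move=> hu huv; rewrite -[v](addKr u) addrC; apply: submoduleB. Qed.

End SubmoduleTheory.

Definition addsm E (L : set E) (M : set E) : set E :=
  [set v | exists u w, [/\ L u, M w & v = u + w]].

Lemma submodule_addsm E (L M : set E) :
  submodule L -> submodule M -> submodule (addsm L M).
Proof.
move=> hL hM; split.
  by exists 0, 0; rewrite addr0; split=> //; exact: submodule0.
move=> a _ _ [u [w [hu hw ->]]] [u' [w' [hu' hw' ->]]].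
exists (a *: u + u'), (a *: w + w'); split; [exact: hL.2|exact: hM.2|].
by rewrite scalerDr addrACA.
Qed.

Lemma addsm_subl E (L M : set E) : submodule M -> L `<=` addsm L M.
Proof. by move=> hM u hu; exists u, 0; rewrite addr0; split=> //; exact: submodule0. Qed.

Lemma addsm_subr E (L M : set E) : submodule L -> M `<=` addsm L M.
Proof. by move=> hM u hu; exists 0, u; rewrite add0r; split=> //; exact: submodule0. Qed.

Lemma addsm_sub E (L M N : set E) : submodule N -> L `<=` N -> M `<=` N ->
  addsm L M `<=` N.
Proof. by move=> hN LN MN _ [u [w [/LN hu /MN hw ->]]]; exact: submoduleD. Qed.

Definition scalesm E (x : R) (P : set E) : set E := [set x *: p | p in P].

Lemma submodule_scalesm E x (P : set E) : submodule P -> submodule (scalesm x P).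
Proof.
move=> hP; split; first by exists 0; rewrite ?scaler0 //; exact: submodule0.
move=> a _ _ [p hp <-] [q hq <-]; exists (a *: p + q); first exact: hP.2.
by rewrite scalerDr !scalerA mulrC.
Qed.

(* Regular sequences on the subquotient P / L, without the condition that the
   final quotient is nonzero. *)
Fixpoint wregular E (P L : set E) (xs : seq R) : Prop :=
  if xs is x :: ys then
    (forall v, P v -> L (x *: v) -> L v) /\ wregular P (addsm L (scalesm x P)) ys
  else True.

(* [nat -> E] serves as the module of power series with coefficients in E, and
   [polysm P] as the submodule of the polynomials with coefficients in P. *)
Definition polysm E (P : set E) : set (nat -> E) :=
  [set f | (forall k, P (f k)) /\ exists b, forall k, (b <= k)%N -> f k = 0].

Lemma submodule_polysm E (P : set E) : submodule P -> submodule (polysm P).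
Proof.
move=> hP; split; first by split=> [k|]; [exact: submodule0 | exists 0%N].
move=> a f g [hf [b hb]] [hg [c hc]]; split=> [k|]; first exact: hP.2.
exists (maxn b c) => k; rewrite geq_max => /andP[bk ck].
by rewrite !fctE hb // hc // scaler0 addr0.
Qed.

Lemma addsm_polysm E (P L : set E) x : submodule P -> submodule L ->
  polysm (addsm L (scalesm x P)) = addsm (polysm L) (scalesm x (polysm P)).
Proof.
move=> hP hL; apply/seteqP; split; last first.
  move=> _ [l [_ [[hl [b hb]] [p [hp [c hc]] <-] ->]]]; split.
    by move=> k; exists (l k), (x *: p k); split=> //; exists (p k).
  exists (maxn b c) => k; rewrite geq_max => /andP[bk ck].
  by rewrite !fctE hb // hc // scaler0 addr0.
move=> f [hf [b hb]].
(* Past the degree bound b of f the chosen pair must be (0, 0); otherwise the chosen coefficients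
   need not form polynomials. *)
have /choice[lp hlp] : forall k, exists lp : E * E, [/\ L lp.1, P lp.2,
    f k = lp.1 + x *: lp.2 & ((b <= k)%N -> lp.1 = 0 /\ lp.2 = 0)].
  move=> k; have [bk|kb] := leqP b k.
    exists (0, 0) => /=; rewrite scaler0 addr0.
    by split; [exact: submodule0|exact: submodule0|exact: hb|].
  by have [l [_ [hl [p hp <-] e]]] := hf k; exists (l, p); split=> //; lia.
exists (fun k => (lp k).1), (x *: (fun k => (lp k).2)); split.
- split=> [k|]; first by case: (hlp k).
  by exists b => k bk; case: (hlp k) => _ _ _ /(_ bk)[].
- exists (fun k => (lp k).2) => //; split=> [k|]; first by case: (hlp k).
  by exists b => k bk; case: (hlp k) => _ _ _ /(_ bk)[].
- by apply/funext => k; case: (hlp k).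
Qed.

Section Generic.
Variable X : {poly R}.

Definition content : set R := ideal_gen [set x | exists i, x = X`_i].

(* Multiplication by z = \sum_i X_i Y^i. *)
Definition zmul E (f : nat -> E) : nat -> E :=
  fun k => \sum_(i < k.+1) X`_i *: f (k - i)%N.

Lemma zmulD E : {morph @zmul E : f g / f + g}.
Proof.
move=> f g; apply/funext => k.
rewrite -[RHS]/(zmul f k + zmul g k) /zmul -big_split.
by apply: eq_bigr => i _; exact: scalerDr.
Qed.

Lemma zmulZ E a : {morph @zmul E : f / a *: f}.
Proof.
move=> f; apply/funext => k; rewrite -[RHS]/(a *: zmul f k) /zmul scaler_sumr.
by apply: eq_bigr => i _; rewrite -[(a *: f) _]/(a *: f _) !scalerA mulrC.
Qed.

Lemma zmulB E : {morph @zmul E : f g / f - g}.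
Proof. by move=> f g; rewrite -[- g]scaleN1r zmulD zmulZ scaleN1r. Qed.

Lemma zmul0 E : @zmul E 0 = 0.
Proof. by rewrite -[X in zmul X](subrr 0) zmulB subrr. Qed.

Lemma polysm_zmul E (P : set E) f : submodule P -> polysm P f -> polysm P (zmul f).
Proof.
move=> hP [hf [b hb]]; split.
  by move=> k; apply: submodule_sum => // i _; apply: submoduleZ.
exists (b + size X)%N => k hk; rewrite /zmul big1 // => i _.
have [hi|hi] := leqP (size X) i; first by rewrite nth_default // scale0r.
rewrite hb ?scaler0 //; lia.
Qed.

Definition zmulsm E (P : set E) : set (nat -> E) := [set zmul p | p in polysm P].

Lemma submodule_zmulsm E (P : set E) : submodule P -> submodule (zmulsm P).
Proof.
move=> hP; have hP' := submodule_polysm hP; split.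
  by exists 0; [exact: submodule0 | exact: zmul0].
move=> a _ _ [p hp <-] [q hq <-]; exists (a *: p + q); first exact: hP'.2.
by rewrite zmulD zmulZ.
Qed.

(* McCoy's argument: if z = \sum_i X_i Y^i kills f, then X_i f_top = 0 for the
   largest i not yet dealt with, so that X_i f has smaller degree and hence
   vanishes by induction on the degree. *)
Lemma mccoy E (P L : set E) : submodule P -> submodule L ->
  (forall u, P u -> (forall i, L (X`_i *: u)) -> L u) ->
  forall f, polysm P f -> (forall k, L (zmul f k)) -> forall k, L (f k).
Proof.
move=> hP hL hX f [hf [b hb]].
have {hb} : forall k, (b <= k)%N -> L (f k).
  by move=> k /hb ->; exact: submodule0.
elim: b f hf => [|b IH] f hf hb hz k; first exact: hb.
suff hXf : forall j i, (size X - j <= i)%N -> forall k, L (X`_i *: f k).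
  by apply: hX => // i; apply: (hXf (size X)); rewrite subnn.
elim=> [|j IHj] i hi l.
  by rewrite subn0 in hi; rewrite nth_default // scale0r; exact: submodule0.
have [hi'|hi'] := leqP (size X - j) i; first exact: IHj.
suff h : forall k, L ((X`_i *: f) k) by exact: (h l).
apply: (IH (X`_i *: f)) => {l}.
- by move=> l; rewrite !fctE; apply: submoduleZ.
- move=> l; rewrite leq_eqVlt => /predU1P[<-|]; last first.
    by move=> bl; rewrite !fctE; apply: submoduleZ => //; exact: hb.
  (* In the coefficient b + i of z f, terms of index below i involve coefficients of f beyond degree
     b, and terms of index above i are covered by [IHj]. All of these lie in L, hence so does the
     remaining term, X_i times the coefficient b of f. *)
  have := hz (b + i)%N; rewrite /zmul.
  have lti : (i < (b + i).+1)%N by lia.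
  rewrite (bigD1 (Ordinal lti)) //= addnK addrC => hs.
  apply: (submodule_addr hL _ hs).
  apply: submodule_sum => // i' /eqP ne.
  have {}ne : i' != i :> nat by apply/eqP => e; apply: ne; apply: val_inj.
  case: (ltngtP i' i) ne => // h _.
    by apply: submoduleZ => //; apply: hb; lia.
  by apply: IHj; lia.
- by move=> l; rewrite zmulZ !fctE; apply: submoduleZ.
Qed.

Lemma content_colon E (L : set E) x u : submodule L -> content x ->
  (forall i, L (X`_i *: u)) -> L (x *: u).
Proof.
move=> hL [c hc ->] h; rewrite scaler_suml big_seq; apply: submodule_sum => // y.
by move=> /hc[i ->]; rewrite -scalerA; apply: submoduleZ.
Qed.

(** The last element of the sequence is traded for z. If x0 v = z w modulo L, then z w vanishes
    modulo L + x0 P, where z is regular by [mccoy] because x1 is. So w = x0 p modulo L, and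
    cancelling x0 gives v = z p modulo L. *)
Lemma wregular_generic E x0 xs (P L : set E) : submodule P -> submodule L ->
  (forall x, x \in x0 :: xs -> content x) -> wregular P L (x0 :: xs) ->
  wregular (polysm P) (addsm (polysm L) (zmulsm P)) (belast x0 xs).
Proof.
elim: xs x0 L => [//|x1 xs IH] x0 L hP hL hc [reg0 reg].
have hL0 := submodule_addsm hL (submodule_scalesm x0 hP).
have hPY := submodule_polysm hP; have hLY := submodule_polysm hL.
split; last first.
  have -> : addsm (addsm (polysm L) (zmulsm P)) (scalesm x0 (polysm P)) =
            addsm (polysm (addsm L (scalesm x0 P))) (zmulsm P).
    rewrite addsm_polysm //; apply/seteqP; split.
      move=> _ [_ [w [[l [z [hl hz ->]]] hw ->]]].
      by exists (l + w), z; split=> //; [exists l, w | rewrite addrAC].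
    move=> _ [_ [z [[l [w [hl hw ->]]] hz ->]]].
    by exists (l + z), w; split=> //; [exists l, z | rewrite addrAC].
  by apply: IH => // x hx; apply: hc; rewrite inE hx orbT.
move=> v hv [l [_ [hl [w hw <-] e]]].
have hx1 u : P u -> (forall i, addsm L (scalesm x0 P) (X`_i *: u)) ->
    addsm L (scalesm x0 P) u.
  move=> hu h; apply: reg.1 => //; apply: content_colon => //.
  by apply: hc; rewrite !inE eqxx orbT.
have : polysm (addsm L (scalesm x0 P)) w.
  split; last exact: hw.2.
  apply: (mccoy hP hL0 hx1 hw) => k; exists (- l k), (x0 *: v k); split.
  - by apply: submoduleN => //; exact: hl.1.
  - by exists (v k) => //; exact: hv.1.
  - by move/(congr1 (@^~ k)): e; rewrite !fctE => ->; rewrite addKr.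
rewrite addsm_polysm // => -[l' [_ [hl' [p hp <-] ew]]].
exists (v - zmul p), (zmul p); split; last by rewrite subrK.
  have hd : polysm L (x0 *: (v - zmul p)).
    rewrite scalerBr -zmulZ e ew zmulD addrA addrK.
    by apply: submoduleD => //; exact: polysm_zmul.
  have hPd : polysm P (v - zmul p).
    by apply: submoduleB => //; exact: polysm_zmul.
  split; last exact: hPd.2.
  by move=> k; apply: reg0; [exact: hPd.1 | exact: hd.1].
by exists p.
Qed.

End Generic.
End Subquotients.

(** * The rank inequality forced by a regular sequence *)

Section RankBound.
Variables (R : comNzRingType) (X : {poly R}).

Lemma coef_mx_mul (A : nzRingType) p q r (B : 'M[{poly A}]_(p, q))
    (C : 'M[{poly A}]_(q, r)) k :
  map_mx (coefp k) (B *m C) =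
  \sum_(i < k.+1) map_mx (coefp (k - i)) B *m map_mx (coefp i) C.
Proof.
apply/matrixP => a b; rewrite !mxE summxE /= coef_sum.
under [RHS]eq_bigr => i _ do rewrite mxE.
rewrite exchange_big /=; apply: eq_bigr => j _.
by rewrite coefMr; apply: eq_bigr => i _; rewrite !mxE.
Qed.

Lemma coef_mx_mulC (A : nzRingType) p q r (B : 'M[{poly A}]_(p, q))
    (C : 'M[A]_(q, r)) k :
  map_mx (coefp k) (B *m map_mx polyC C) = map_mx (coefp k) B *m C.
Proof.
apply/matrixP => a b; rewrite !mxE /= coef_sum; apply: eq_bigr => j _.
by rewrite !mxE coefMC.
Qed.

Lemma coef_mx_inj (A : nzRingType) p q (B : 'M[{poly A}]_(p, q)) :
  (forall k, map_mx (coefp k) B = 0) -> B = 0.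
Proof.
move=> h; apply/matrixP => a b; apply/polyP => k; rewrite mxE coef0.
by move/matrixP/(_ a b): (h k); rewrite !mxE.
Qed.

Lemma coef_mx_eventually0 (A : nzRingType) p q (B : 'M[{poly A}]_(p, q)) :
  exists b, forall k, (b <= k)%N -> map_mx (coefp k) B = 0.
Proof.
exists (\max_a \max_b size (B a b)) => k hk; apply/matrixP => a b.
rewrite !mxE /= nth_default // (leq_trans _ hk) //.
apply: leq_trans (leq_bigmax a); exact: (leq_bigmax b).
Qed.

Definition polymap (A : nzRingType) (E : zmodType) p (phi : 'rV[A]_p -> E)
    (u : 'rV[{poly A}]_p) : nat -> E :=
  fun k => phi (map_mx (coefp k) u).

(* Invariant of the induction: phi and psi describe the classes in P/L of A-linear
   combinations of fixed elements of degree s + 1 and s, Z is the matrix of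
   multiplication by z, and the rows of C are relations already produced. *)
Lemma wregular_rank (d : nat) : forall (A : idomainType) (E : lmodType R)
  (P L Q : set E) (h h' r : nat) (phi : {additive 'rV[A]_h' -> E})
  (psi : {additive 'rV[A]_h -> E}) (Z : 'M[{poly A}]_(h, h')) (C : 'M[A]_(r, h'))
  (xs : seq R),
  size xs = d -> submodule P -> submodule L -> submodule Q ->
  L `<=` Q -> (forall i u, P u -> Q (X`_i *: u)) ->
  (forall u, P (psi u)) -> (forall u, Q (psi u) -> u = 0) ->
  (forall i u, X`_i *: psi u = phi (u *m map_mx (coefp i) Z)) ->
  (forall c : 'rV_r, L (phi (c *m C))) -> (forall c : 'rV_r, c *m C = 0 -> c = 0) ->
  (forall x, x \in xs -> content X x) -> wregular P L xs ->
  (r + d * h <= h')%N.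
Proof.
elim: d => [|d IH] A E P L Q h h' r phi psi Z C xs hsz hP hL hQ LQ XQ hpsi hinj
  hZ hC Cinj hX hreg.
  by rewrite mul0n addn0; exact: row_inj_leq Cinj.
case: xs hsz hX hreg => [//|x0 xs] [hsz] hX hreg.
have polymap_zmod p (f : {additive 'rV[A]_p -> E}) : zmod_morphism (polymap f).
  move=> u v; apply/funext => k.
  by rewrite -[RHS]/(polymap f u k - polymap f v k) /polymap raddfB raddfB.
pose padd p f := GRing.isZmodMorphism.Build _ _ _ (polymap_zmod p f).
pose phi' : {additive 'rV[{poly A}]_h' -> (nat -> E)} :=
  HB.pack (polymap phi) (padd _ phi).
pose psi' : {additive 'rV[{poly A}]_h -> (nat -> E)} :=
  HB.pack (polymap psi) (padd _ psi).
have zpsi g : zmul X (psi' g) = phi' (g *m Z).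
  apply/funext => k; rewrite -[phi' _ k]/(phi (map_mx (coefp k) (g *m Z))).
  rewrite coef_mx_mul raddf_sum /zmul; apply: eq_bigr => i _.
  exact: hZ.
have psiP g : polysm P (psi' g).
  split=> [k|]; first exact: hpsi.
  have [b hb] := coef_mx_eventually0 g; exists b => k bk.
  by rewrite -[psi' g k]/(psi (map_mx (coefp k) g)) hb // raddf0.
have phiC c : polysm L (phi' (c *m map_mx polyC C)).
  have e k : phi' (c *m map_mx polyC C) k = phi (map_mx (coefp k) c *m C).
    by rewrite -[LHS]/(phi (map_mx (coefp k) _)) coef_mx_mulC.
  split=> [k|]; first by rewrite e.
  have [b hb] := coef_mx_eventually0 c; exists b => k bk.
  by rewrite e hb // mul0mx raddf0.
have hPY := submodule_polysm hP; have hLY := submodule_polysm hL.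
pose QY : set (nat -> E) := [set f | forall k, Q (f k)].
have hQY : submodule QY.
  split=> [k|a u v hu hv k]; [exact: submodule0 | exact: hQ.2].
rewrite mulSn addnA.
(* A fresh variable is adjoined to A and E, while R and X stay fixed and R acts coefficientwise. The
   rows of Z become h new relations, and the last element of the sequence is dropped by
   [wregular_generic]. *)
apply: (IH {poly A} (nat -> E) (polysm P) (addsm (polysm L) (zmulsm X P)) QY
  h h' (r + h)%N phi' psi' (map_mx (map_poly polyC) Z)
  (col_mx (map_mx polyC C) Z) (belast x0 xs)) => //.
- by rewrite size_belast.
- by apply: submodule_addsm => //; exact: submodule_zmulsm.
- apply: addsm_sub => // [f [hf _] k|_ [p [hp _] <-] k]; first exact: LQ.
  by apply: submodule_sum => // i _; exact: XQ.
- by move=> i u [hu _] k; exact: XQ.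
- move=> u hu; apply: coef_mx_inj => k; apply: hinj; exact: (hu k).
- move=> i u; apply/funext => k.
  rewrite -[LHS]/(X`_i *: psi (map_mx (coefp k) u)) hZ.
  rewrite -[RHS]/(phi (map_mx (coefp k) _)).
  suff -> : map_mx (coefp i) (map_mx (map_poly polyC) Z) =
            map_mx polyC (map_mx (coefp i) Z) by rewrite coef_mx_mulC.
  by apply/matrixP => a b; rewrite !mxE /= coef_map.
- move=> c; rewrite -[c]hsubmxK mul_row_col raddfD.
  exists (phi' (lsubmx c *m map_mx polyC C)), (phi' (rsubmx c *m Z)).
  split=> //; rewrite -zpsi; exists (psi' (rsubmx c)) => //.
(* Independence of the enlarged family of relations: if c1 C + c2 Z = 0, then z kills [psi' c2]
   modulo L, so [psi' c2] has coefficients in L by [mccoy]. As L is contained in Q, this forces c2 =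
   0, and then c1 = 0. *)
- move=> c; rewrite -[c]hsubmxK mul_row_col; set c1 := lsubmx c; set c2 := rsubmx c.
  move=> e.
  have hz k : L (zmul X (psi' c2) k).
    rewrite zpsi -[X in phi' X](addKr (c1 *m map_mx polyC C)) e addr0 raddfN.
    by apply: (submoduleN hL); exact: (phiC c1).1.
  have hx1 u : P u -> (forall i, L (X`_i *: u)) -> L u.
    move=> hu h1; apply: hreg.1 => //; apply: content_colon => //.
    by apply: hX; rewrite inE eqxx.
  have c20 : c2 = 0.
    apply: coef_mx_inj => k; apply: hinj; apply: LQ.
    exact: (mccoy hP hL hx1 (psiP c2) hz).
  have c10 : c1 = 0.
    apply: coef_mx_inj => k; apply: Cinj.
    by rewrite -coef_mx_mulC; move: e; rewrite c20 mul0mx addr0 => ->; rewrite raddf0.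
  by rewrite c10 c20 row_mx0.
- by move=> x /mem_belast; exact: hX.
- exact: (wregular_generic hP hL hX hreg).
Qed.

End RankBound.

(** * Graded modules *)

Section KLinear.
Variables (K : fieldType) (n : nat) (N : lmodType {mpoly K[n]}).
Implicit Types (b : seq N) (V : set N).

Definition lincomb b (c : nat -> K) : N := \sum_(i < size b) (c i)%:MP *: b`_i.

Definition Kspan b : set N := [set v | exists c, v = lincomb b c].

Definition Kfree b := forall c, lincomb b c = 0 -> forall i, (i < size b)%N -> c i = 0.

Lemma is_KbasisE V b :
  is_Kbasis V b <-> [/\ forall v, v \in b -> V v, Kfree b & V `<=` Kspan b].
Proof. by []. Qed.

Lemma lincomb_cons v b c : lincomb (v :: b) c = (c 0%N)%:MP *: v + lincomb b (c \o succn).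
Proof. by rewrite /lincomb /= big_ord_recl. Qed.

Lemma eq_lincomb b c c' : (forall i, (i < size b)%N -> c i = c' i) ->
  lincomb b c = lincomb b c'.
Proof. by move=> e; apply: eq_bigr => i _; rewrite e. Qed.

Lemma lincombD b c c' : lincomb b c + lincomb b c' = lincomb b (fun i => c i + c' i).
Proof.
by rewrite -big_split; apply: eq_bigr => i _; rewrite /= mpolyCD scalerDl.
Qed.

Lemma lincombZ b a c : a%:MP *: lincomb b c = lincomb b (fun i => a * c i).
Proof.
by rewrite scaler_sumr; apply: eq_bigr => i _; rewrite scalerA mpolyCM.
Qed.

Lemma lincomb0 b c : (forall i, (i < size b)%N -> c i = 0) -> lincomb b c = 0.
Proof. by move=> h; apply: big1 => i _; rewrite h // mpolyC0 scale0r. Qed.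

Lemma Kspan0 b : Kspan b 0.
Proof. by exists (fun=> 0); rewrite lincomb0. Qed.

Lemma KspanD b u v : Kspan b u -> Kspan b v -> Kspan b (u + v).
Proof. by move=> [c ->] [c' ->]; rewrite lincombD; eexists. Qed.

Lemma KspanZ b a v : Kspan b v -> Kspan b (a%:MP *: v).
Proof. by move=> [c ->]; rewrite lincombZ; eexists. Qed.

Lemma Kspan_sum b I (r : seq I) (Q : pred I) (F : I -> N) :
  (forall i, Q i -> Kspan b (F i)) -> Kspan b (\sum_(i <- r | Q i) F i).
Proof. by move=> h; apply: (big_ind (Kspan b)) => //; [exact: Kspan0|exact: KspanD]. Qed.

Lemma mem_Kspan b v : v \in b -> Kspan b v.
Proof.
elim: b => [//|w b IH]; rewrite inE => /predU1P[->|/IH[c ->]].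
  exists (fun i => (i == 0)%:R); rewrite lincomb_cons mpolyC1 scale1r.
  by rewrite lincomb0 ?addr0.
exists (fun i => if i is j.+1 then c j else 0).
by rewrite lincomb_cons mpolyC0 scale0r add0r.
Qed.

Lemma Kspan_sub b b' : (forall v, v \in b -> Kspan b' v) -> Kspan b `<=` Kspan b'.
Proof.
move=> h _ [c ->]; apply: Kspan_sum => i _; apply: KspanZ; apply: h.
exact: mem_nth.
Qed.

Lemma Kfree_cons v b : Kfree b -> ~ Kspan b v -> Kfree (v :: b).
Proof.
move=> hb hv c; rewrite lincomb_cons => e.
have c0 : c 0%N = 0.
  apply/eqP/negPn/negP => c0; apply: hv.
  have -> : v = (- (c 0%N)^-1)%:MP *: lincomb b (c \o succn).
    move/eqP: e; rewrite addrC addr_eq0 => /eqP ->.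
    by rewrite scalerN mpolyCN scaleNr opprK scalerA -mpolyCM mulVf // mpolyC1 scale1r.
  by apply: KspanZ; eexists.
move: e; rewrite c0 mpolyC0 scale0r add0r => /hb h [|i] hi; first exact: c0.
exact: (h i hi).
Qed.

Lemma ex_Kfree b : exists b',
  [/\ {subset b' <= b}, Kfree b' & Kspan b `<=` Kspan b'].
Proof.
elim: b => [|v b [b' [sb fb hb]]]; first by exists [::]; split=> // c _ i.
have [hv|hv] := EM (Kspan b' v).
  exists b'; split=> //; first by move=> w /sb; rewrite inE orbC => ->.
  apply: Kspan_sub => w; rewrite inE => /predU1P[->//|wb].
  exact/hb/mem_Kspan.
exists (v :: b'); split; last 1 first.
- apply: Kspan_sub => w; rewrite inE => /predU1P[->|wb].
    by apply: mem_Kspan; rewrite mem_head.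
  have := hb _ (mem_Kspan wb); apply: Kspan_sub => x xb.
  by apply: mem_Kspan; rewrite inE xb orbT.
- by move=> w; rewrite !inE => /predU1P[->|/sb ->]; rewrite ?eqxx ?orbT.
- exact: Kfree_cons.
Qed.

(** The matrix of coordinates of b with respect to b' is injective on row vectors, so [row_inj_leq]
    applies. *)
Lemma Kfree_leq b b' : Kfree b -> (forall v, v \in b -> Kspan b' v) ->
  (size b <= size b')%N.
Proof.
move=> fb hb; have /choice[c hc] : forall i : 'I_(size b), exists c, b`_i = lincomb b' c.
  by move=> i; apply: hb; exact: mem_nth.
apply: (@row_inj_leq _ _ _ (\matrix_(i < size b, j < size b') c i j)) => x x0.
apply/rowP => i; rewrite mxE.
pose y k := if insub k is Some j then x 0 j else 0.
have yE (j : 'I_(size b)) : y j = x 0 j by rewrite /y valK.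
rewrite -yE; apply: (fb y) => //.
rewrite /lincomb; under eq_bigr => k _ do rewrite hc yE lincombZ.
rewrite exchange_big big1 //= => j _.
rewrite -scaler_suml -raddf_sum /=; move/rowP/(_ j): x0.
rewrite !mxE => x0; rewrite (_ : \sum_(i < _) _ = 0) ?mpolyC0 ?scale0r //.
by rewrite -[RHS]x0; apply: eq_bigr => k _; rewrite mxE.
Qed.

Lemma dimK_basis V b : is_Kbasis V b -> dimK V = size b.
Proof.
move=> hb; rewrite /dimK; apply: xget_unique; first by exists b.
move=> _ [b' <- hb']; move: hb hb' => /is_KbasisE[h1 h2 h3] /is_KbasisE[h4 h5 h6].
apply/eqP; rewrite eqn_leq !Kfree_leq //.
  by move=> v /h1/h6.
by move=> v /h4/h3.
Qed.

Lemma ex_Kbasis V b : (forall v, v \in b -> V v) -> V `<=` Kspan b ->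
  exists2 b', size b' = dimK V & is_Kbasis V b'.
Proof.
move=> hb hV; have [b' [sb fb hb']] := ex_Kfree b.
have h : is_Kbasis V b'.
  apply/is_KbasisE; split=> //; first by move=> v /sb/hb.
  by move=> v /hV/hb'.
by exists b' => //; rewrite (dimK_basis h).
Qed.

End KLinear.

(** * Homogeneous components, their projections and their finite dimension *)

Section Graded.
Variables (K : fieldType) (n : nat) (N : gradedModule K n).
Implicit Types (u v w : N) (f : int -> N) (k : int).

Lemma gr_compN k v : gr_comp k v -> gr_comp k (- v).
Proof. by move=> hv; rewrite -sub0r; apply: gr_compB => //; exact: gr_comp0. Qed.

Lemma gr_compD k u v : gr_comp k u -> gr_comp k v -> gr_comp k (u + v).
Proof. by move=> hu hv; rewrite -[v]opprK; apply: gr_compB => //; exact: gr_compN. Qed.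

Lemma gr_compMn k v m : gr_comp k v -> gr_comp k (v *+ m).
Proof.
move=> hv; elim: m => [|m IH]; first by rewrite mulr0n; exact: gr_comp0.
by rewrite mulrS; exact: gr_compD.
Qed.

Lemma gr_compC k a v : gr_comp k v -> gr_comp k (a%:MP *: v).
Proof.
move=> hv; rewrite -[k]add0r; apply: gr_compZ => //.
by rewrite -[a%:MP]mulr1 mul_mpolyC; apply: dhomogZ; exact: dhomog1.
Qed.

Lemma gr_comp_sum k I (r : seq I) (Q : pred I) (F : I -> N) :
  (forall i, Q i -> gr_comp k (F i)) -> gr_comp k (\sum_(i <- r | Q i) F i).
Proof.
by move=> h; apply: (big_ind (gr_comp k)) => //; [exact: gr_comp0 | exact: gr_compD].
Qed.

Definition decomposition v f :=
  (forall k, gr_comp k (f k)) /\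
  exists I : seq int, [/\ uniq I, forall k, k \notin I -> f k = 0 & v = \sum_(k <- I) f k].

Lemma ex_decomposition v : exists f, decomposition v f.
Proof.
have [I [f [hf ->]]] := gr_span v.
(* [gr_span] allows repeated degrees in I, so the component of degree k is f k taken with its
   multiplicity. *)
exists (fun k => f k *+ count_mem k I); split.
  by move=> k; exact: gr_compMn.
exists (undup I); split; first exact: undup_uniq.
  by move=> k; rewrite mem_undup => /count_memPn ->.
by rewrite -(big_undup_iterop_count +%R).
Qed.

Lemma sum_extend (I J : seq int) f : uniq I -> uniq J -> {subset I <= J} ->
  (forall k, k \notin I -> f k = 0) -> \sum_(k <- J) f k = \sum_(k <- I) f k.
Proof.
move=> uI uJ IJ hf; rewrite (bigID (mem I)) /= [X in _ + X]big1 ?addr0; last first.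
  by move=> k /hf.
rewrite -big_filter; apply: perm_big; apply: uniq_perm => //; first exact: filter_uniq.
by move=> k; rewrite mem_filter; case: (boolP (k \in I)) => // /IJ ->.
Qed.

Lemma decompositionB u v f g :
  decomposition u f -> decomposition v g -> decomposition (u - v) (fun k => f k - g k).
Proof.
move=> [hf [I [uI fI ->]]] [hg [J [uJ gJ ->]]]; split.
  by move=> k; exact: gr_compB.
exists (undup (I ++ J)); split; first exact: undup_uniq.
  by move=> k; rewrite mem_undup mem_cat negb_or => /andP[/fI -> /gJ ->]; rewrite subr0.
rewrite sumrB; congr (_ - _); symmetry; apply: sum_extend => //; rewrite ?undup_uniq //.
  by move=> k kI; rewrite mem_undup mem_cat kI.
by move=> k kJ; rewrite mem_undup mem_cat kJ orbT.
Qed.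

Lemma decomposition_uniq v f g :
  decomposition v f -> decomposition v g -> f = g.
Proof.
move=> df dg; have [h [I [uI hI]]] := decompositionB df dg; rewrite subrr => e.
apply/funext => k; apply/eqP; rewrite -subr_eq0; apply/eqP.
have [kI|/hI //] := boolP (k \in I).
exact: (gr_direct uI h (esym e)).
Qed.

Definition gproj k v : N := sval (cid (ex_decomposition v)) k.

Lemma gprojP v : decomposition v (gproj^~ v).
Proof. exact: (svalP (cid (ex_decomposition v))). Qed.

Lemma gprojE v f : decomposition v f -> forall k, gproj k v = f k.
Proof. by move=> df k; rewrite -(decomposition_uniq (gprojP v) df). Qed.

Lemma gproj_comp k v : gr_comp k (gproj k v).
Proof. exact: (gprojP v).1. Qed.

Lemma gproj_is_zmod_morphism k : zmod_morphism (gproj k).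
Proof. by move=> u v; exact: (gprojE (decompositionB (gprojP u) (gprojP v))). Qed.

HB.instance Definition _ k :=
  GRing.isZmodMorphism.Build N N (gproj k) (gproj_is_zmod_morphism k).

Lemma gproj_id k v : gr_comp k v -> gproj k v = v.
Proof.
move=> hv; pose f j := if j == k then v else 0.
suff df : decomposition v f by rewrite (gprojE df) /f eqxx.
split; first by move=> j; rewrite /f; case: eqP => [->//|_]; exact: gr_comp0.
exists [:: k]; split=> //; last by rewrite big_seq1 /f eqxx.
by move=> j; rewrite inE /f => /negPf ->.
Qed.

Lemma gprojZ d k p v : p \is d.-homog -> gproj k (p *: v) = p *: gproj (k - d%:Z) v.
Proof.
move=> hp; have [h [I [uI hI e]]] := gprojP v.
pose f j := p *: gproj (j - d%:Z) v.
suff df : decomposition (p *: v) f by rewrite (gprojE df).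
split; first by move=> j; have := gr_compZ hp (h (j - d%:Z)); rewrite addrCA subrr addr0.
exists [seq j + d%:Z | j <- I]; split.
- by rewrite map_inj_uniq //; exact: addIr.
- move=> j hj; rewrite /f hI ?scaler0 //; apply: contra hj => hj; apply/mapP.
  by exists (j - d%:Z) => //; rewrite subrK.
- by rewrite big_map {1}e scaler_sumr; apply: eq_bigr => j _; rewrite /f addrK.
Qed.

Lemma gproj_lowest v : exists B : nat, forall k, k < - B%:Z -> gproj k v = 0.
Proof.
have [_ [I [_ hI _]]] := gprojP v.
exists (\max_(j <- I) `|j|)%N => k hk; apply: hI; apply/negP => kI.
have : (`|k| <= \max_(j <- I) `|j|)%N by apply: leq_bigmax_seq.
lia.
Qed.

Lemma gprojM k p v : gproj k (p *: v) =
  \sum_(m <- msupp p) (p@_m *: 'X_[m]) *: gproj (k - (mdeg m)%:Z) v.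
Proof.
rewrite {1}(mpolyE p) scaler_suml raddf_sum; apply: eq_bigr => m _.
by apply: gprojZ; apply: dhomogZ; rewrite dhomogX.
Qed.

Lemma gr_comp_finite k : fin_gen N -> exists b : seq N,
  (forall v, v \in b -> gr_comp k v) /\ gr_comp k `<=` Kspan b.
Proof.
move=> [g hg].
have /choice[B hB] : forall i, exists B : nat, forall k, k < - B%:Z -> gproj k g`_i = 0.
  by move=> i; exact: gproj_lowest.
(* A monomial of degree at least D could reach degree k only from a component of a generator in
   degree below - B i, and these components vanish. So finitely many monomials suffice. *)
pose D := (`|k| + \max_(i < size g) B i).+1.
pose F (m : 'X_{1..n < D}) (i : 'I_(size g)) := 'X_[m] *: gproj (k - (mdeg m)%:Z) g`_i.
exists [seq F m i | m <- index_enum _, i <- index_enum _]; split.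
  move=> _ /allpairsP[[m i] [_ _ ->]]; rewrite /F /=.
  have hX : ('X_[m] : {mpoly K[n]}) \is (mdeg m).-homog by rewrite dhomogX.
  have := gr_compZ hX (gproj_comp (k - (mdeg m)%:Z) g`_i).
  by rewrite addrCA subrr addr0.
move=> v hv; have [c e] := hg v.
rewrite -(gproj_id hv) e raddf_sum /=; apply: Kspan_sum => i _.
rewrite gprojM; apply: Kspan_sum => m _.
rewrite -mul_mpolyC -scalerA; apply: KspanZ.
have [hm|hm] := ltnP (mdeg m) D.
  apply: mem_Kspan; apply/allpairsP; exists (BMultinom hm, i).
  by rewrite !mem_index_enum.
rewrite hB ?scaler0; first exact: Kspan0.
have : (B i <= \max_(i < size g) B i)%N by apply: leq_bigmax.
by rewrite /D in hm; lia.
Qed.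

Lemma ex_gr_basis k : fin_gen N ->
  exists2 b : seq N, size b = hilbert_series N k & is_Kbasis (gr_comp k) b.
Proof. by move=> /(gr_comp_finite k)[b [hb hb']]; exact: ex_Kbasis hb hb'. Qed.

Lemma hilbert_series_eq0 k v :
  fin_gen N -> hilbert_series N k = 0%N -> gr_comp k v -> v = 0.
Proof.
move=> fN h0 /=; have [b] := ex_gr_basis k fN; rewrite h0 => /size0nil ->.
by move=> [_ _ h] /h[c ->]; rewrite big_ord0.
Qed.

End Graded.

Section Regular.
Variables (K : fieldType) (n : nat).

Lemma submodule_seq_submod (N : lmodType {mpoly K[n]}) xs :
  submodule (@seq_submod K n N xs).
Proof.
split; first by exists (fun=> 0); rewrite big1 // => i _; rewrite scaler0.
move=> a _ _ [u ->] [v ->]; exists (fun i => a *: u i + v i).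
rewrite scaler_sumr -big_split; apply: eq_bigr => i _.
by rewrite scalerDr !scalerA mulrC.
Qed.

Lemma seq_submod_nil (N : lmodType {mpoly K[n]}) : @seq_submod K n N [::] = [set 0].
Proof.
apply/seteqP; split=> [v [u ->]|v ->]; first by rewrite big_ord0.
by exists (fun=> 0); rewrite big_ord0.
Qed.

Lemma seq_submod_cons (N : lmodType {mpoly K[n]}) x xs :
  @seq_submod K n N (x :: xs) = addsm (scalesm x setT) (seq_submod xs).
Proof.
apply/seteqP; split=> [_ [u ->]|_ [_ [_ [[p _ <-] [u ->] ->]]]].
  rewrite big_ord_recl /=; exists (x *: u 0%N), (\sum_(i < size xs) xs`_i *: u i.+1).
  by split=> //; [exists (u 0%N) | exists (fun i => u i.+1)].
exists (fun i => if i is j.+1 then u j else p).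
by rewrite big_ord_recl.
Qed.

Lemma addsmA (N : lmodType {mpoly K[n]}) : associative (@addsm _ N).
Proof.
move=> A B C; apply/seteqP; split.
  move=> _ [a [_ [ha [b [c [hb hc ->]]] ->]]]; exists (a + b), c; rewrite addrA.
  by split=> //; exists a, b.
move=> _ [_ [c [[a [b [ha hb ->]]] hc ->]]]; exists a, (b + c); rewrite addrA.
by split=> //; exists b, c.
Qed.

Lemma addsm0 (N : lmodType {mpoly K[n]}) (L : set N) : addsm L [set 0] = L.
Proof.
apply/seteqP; split=> [_ [a [_ [ha -> ->]]]|a ha]; first by rewrite addr0.
by exists a, 0; rewrite addr0.
Qed.

Lemma add0sm (N : lmodType {mpoly K[n]}) (L : set N) : addsm [set 0] L = L.
Proof.
apply/seteqP; split=> [_ [_ [a [-> ha ->]]]|a ha]; first by rewrite add0r.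
by exists 0, a; rewrite add0r.
Qed.

(** For L = 0 this links the recursive form of regularity, suited to induction, with the indexed
    form in [regular_seq]. *)
Lemma wregularP (N : lmodType {mpoly K[n]}) (L : set N) xs :
  wregular setT L xs <->
  (forall i, (i < size xs)%N -> forall v,
     addsm L (seq_submod (take i xs)) (xs`_i *: v) ->
     addsm L (seq_submod (take i xs)) v).
Proof.
elim: xs L => [//|x xs IH] L /=; rewrite IH; split=> [[h1 h2] [|i] hi v|h].
- by rewrite /= seq_submod_nil addsm0; exact: h1.
- by rewrite /= seq_submod_cons addsmA; exact: h2.
split=> [v _|i hi v]; last first.
  by have := h i.+1 hi v; rewrite /= seq_submod_cons addsmA.
by have := h 0%N isT v; rewrite /= seq_submod_nil addsm0.
Qed.

End Regular.

(** * Regular sequences and the two lowest values of the Hilbert function *)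

Section UpperBound.
Variables (K : fieldType) (n : nat) (N : gradedModule K n).

Lemma sum_coefX (i : nat) :
  (\sum_(j < n) 'X_j *: 'X^j : {poly {mpoly K[n]}})`_i =
  if insub i is Some j then 'X_j else 0.
Proof.
rewrite coef_sum; case: insubP => [j hj <-|hi].
  rewrite (bigD1 j) //= coefZ coefXn eqxx mulr1 big1 ?addr0 // => k kj.
  by rewrite coefZ coefXn eq_sym val_eqE (negPf kj) mulr0.
rewrite big1 // => j _; rewrite coefZ coefXn.
by case: eqP => [e|]; rewrite ?mulr0 //; rewrite e ltn_ord in hi.
Qed.

(** [wregular_rank] is started with A = K, P = N, L = 0 and no relations. Here z is the generic
    linear form, and Z is the matrix of multiplication by z from degree s to degree s + 1 in K-bases
    of these components. *)
Lemma regular_seq_hilbert (s : nat) (xs : seq {mpoly K[n]}) :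
  fin_gen N -> (forall k : int, k < s -> hilbert_series N k = 0%N) ->
  (forall x, x \in xs -> max_ideal x) -> regular_seq N xs ->
  (size xs * hilbert_series N s <= hilbert_series N s.+1)%N.
Proof.
move=> fN h0 hxs [hreg _].
have [b szb /is_KbasisE[bV bfree bspan]] := ex_gr_basis s fN.
have [b' szb' /is_KbasisE[bV' bfree' bspan']] := ex_gr_basis s.+1 fN.
rewrite -szb -szb'.
pose X : {poly {mpoly K[n]}} := \sum_(j < n) 'X_j *: 'X^j.
have Xhom i : X`_i \is 1.-homog.
  rewrite sum_coefX; case: insub => [j|]; last exact: dhomog0.
  by rewrite dhomogX; apply/eqP; exact: mdeg1.
have /choice[M hM] : forall ia : nat * nat, exists c : nat -> K,
    X`_ia.1 *: nth 0 b ia.2 = lincomb b' c.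
  move=> [i a]; apply: bspan' => /=; rewrite -[s.+1%:Z]/(1%:Z + s).
  apply: gr_compZ => //; have [ab|ba] := ltnP a (size b).
    by apply: bV; exact: mem_nth.
  by rewrite nth_default //; exact: gr_comp0.
pose lc (c : seq N) (u : 'rV[K]_(size c)) := \sum_(j < size c) (u 0 j)%:MP *: nth 0 c j.
have lc_zmod c : zmod_morphism (@lc c).
  move=> u v; rewrite -sumrB; apply: eq_bigr => j _.
  by rewrite !mxE mpolyCB scalerBl.
pose lcadd c : {additive 'rV[K]_(size c) -> N} :=
  HB.pack (@lc c) (GRing.isZmodMorphism.Build _ _ _ (lc_zmod c)).
pose Z : 'M[{poly K}]_(size b, size b') := \matrix_(a, j) \poly_(i < n) M (i, val a) j.
(* Since N vanishes below degree s, all products X_i u lie in degrees above s, that is in Q, while Q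
   meets the component of degree s only in 0. *)
pose Q : set N := [set v | forall k : int, k <= s -> gproj k v = 0].
have hT : submodule (setT : set N) by [].
have h00 : submodule ([set 0] : set N).
  by split=> // a u v -> ->; rewrite scaler0 addr0.
have hcoef x : x \in xs -> content X x.
  move=> /hxs [c hc ->]; exists c => // y /hc[j ->]; exists j.
  by rewrite sum_coefX valK.
rewrite -[(_ * _)%N]add0n.
apply: (@wregular_rank _ X (size xs) K N setT [set 0] Q _ _ _ (lcadd b')
  (lcadd b) Z (0 : 'M_(0, _)) xs) => //.
- split=> [k _|a u v hu hv k hk]; first exact: raddf0.
  rewrite raddfD /= hv // addr0 gprojM big1 // => m _.
  by rewrite hu ?scaler0 //; lia.
- by move=> _ -> k _; rewrite raddf0.
- move=> i u _ k hk; rewrite (gprojZ _ _ (Xhom i)).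
  rewrite (hilbert_series_eq0 fN _ (gproj_comp (k - 1%:Z) u)) ?scaler0 //.
  by apply: h0; lia.
- move=> u /(_ s (lexx _)); rewrite gproj_id => [e|]; last first.
    apply: gr_comp_sum => j _; apply: gr_compC; apply: bV; exact: mem_nth.
  apply/rowP => j; rewrite mxE.
  pose c k := if insub k is Some j then u 0 j else 0.
  have <- : c j = u 0 j by rewrite /c valK.
  apply: bfree => //; rewrite -[RHS]e; apply: eq_bigr => k _.
  by rewrite /c valK.
- move=> i u.
  rewrite -[RHS]/(\sum_(j < size b') ((u *m map_mx (coefp i) Z) 0 j)%:MP *: nth 0 b' j).
  rewrite -[lcadd b u]/(\sum_(j < size b) (u 0 j)%:MP *: nth 0 b j).
  under [RHS]eq_bigr => j _ do rewrite mxE raddf_sum scaler_suml.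
  rewrite exchange_big scaler_sumr /=; apply: eq_bigr => a _.
  rewrite scalerA mulrC -scalerA (hM (i, val a)) scaler_sumr /=.
  have [ltin|leni] := ltnP i n.
    by apply: eq_bigr => j _; rewrite !mxE /= coef_poly ltin scalerA -mpolyCM.
  transitivity (0 : N).
    rewrite -scaler_sumr -[X in _ *: X]/(lincomb b' (M (i, val a))) -hM /=.
    by rewrite sum_coefX insubF ?scale0r ?scaler0 // ltnNge leni.
  rewrite big1 // => j _; rewrite !mxE /= coef_poly ltnNge leni /=.
  by rewrite mulr0 mpolyC0 scale0r.
- by move=> c; rewrite mulmx0 raddf0.
- by move=> c _; exact: thinmx0.
- apply/wregularP => i hi v; rewrite !add0sm; exact: hreg.
Qed.

End UpperBound.

(** * Direct sums of shifted polynomial rings *)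

(* n is a phantom argument recording the ring that acts. *)
Definition polymod (K : fieldType) (n i : nat) : Type := {mpoly K[i]}.

HB.instance Definition _ K n i := GRing.Zmodule.on (polymod K n i).

Section Truncation.
Variables (K : fieldType) (n i : nat).

(** Restriction of scalars along this map makes K[X_1, ..., X_i] a module over the polynomial ring
    in n variables. *)
Definition truncX : {mpoly K[n]} -> {mpoly K[i]} := comp_mpoly
  [tuple (if insub (val j) : option 'I_i is Some l then 'X_l else 0) | j < n].

HB.instance Definition _ := GRing.RMorphism.on truncX.

Lemma truncX_X (j : 'I_n) :
  truncX 'X_j = if insub (val j) : option 'I_i is Some l then 'X_l else 0.
Proof. by rewrite /truncX comp_mpolyXU -tnth_nth tnth_mktuple. Qed.

Lemma truncX_C c : truncX c%:MP = c%:MP.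
Proof. exact: comp_mpolyC. Qed.

Lemma truncX_homog d p : p \is d.-homog -> truncX p \is d.-homog.
Proof.
move=> hp; rewrite /truncX comp_mpolyEX big_seq; apply: rpred_sum => m mp.
apply: dhomogZ; have <- : mdeg m = d := dhomog_mf hp mp.
rewrite comp_mpolyX mdegE.
elim/big_rec2: _ => [|j e q _ hq]; first exact: dhomog1.
apply: dhomogM => //; rewrite tnth_mktuple -[X in X.-homog]mul1n; apply: dhomogMn.
case: insub => [l|]; last exact: dhomog0.
by rewrite dhomogX; apply/eqP; exact: mdeg1.
Qed.

Lemma truncX_surj : (i <= n)%N -> forall v, exists p, truncX p = v.
Proof.
move=> le v; pose im v := exists p, truncX p = v.
have imX j : im 'X_j.
  exists 'X_(widen_ord le j); rewrite truncX_X.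
  case: insubP => [l _ el|]; last by rewrite /= ltn_ord.
  by rewrite (_ : l = j) //; exact: val_inj.
have im1 : im 1 by exists 1; rewrite rmorph1.
have imM u w : im u -> im w -> im (u * w).
  by move=> [p <-] [q <-]; exists (p * q); rewrite rmorphM.
have imD u w : im u -> im w -> im (u + w).
  by move=> [p <-] [q <-]; exists (p + q); rewrite rmorphD.
rewrite -/(im v) (mpolyE v).
apply: (big_ind im) => [|u w|m _]; [by exists 0; rewrite rmorph0|exact: imD|].
rewrite -mul_mpolyC; apply: (imM); first by exists (v@_m)%:MP; exact: truncX_C.
rewrite mpolyXE_id; apply: (big_ind im) => [|u w|j _]; [exact: im1|exact: imM|].
by elim: (m j) => [|e IH]; rewrite ?expr0 // exprS; apply: imM.
Qed.


Local Notation polymod := (polymod K n i).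

Definition polymod_scale (p : {mpoly K[n]}) (v : polymod) : polymod :=
  truncX p * (v : {mpoly K[i]}).

Lemma polymod_scaleA p q v : polymod_scale p (polymod_scale q v) = polymod_scale (p * q) v.
Proof. by rewrite /polymod_scale rmorphM mulrA. Qed.

Lemma polymod_scale1 : left_id 1 polymod_scale.
Proof. by move=> v; rewrite /polymod_scale rmorph1 mul1r. Qed.

Lemma polymod_scaleDr : right_distributive polymod_scale +%R.
Proof. by move=> p u v; rewrite /polymod_scale mulrDr. Qed.

Lemma polymod_scaleDl v : {morph polymod_scale^~ v : p q / p + q}.
Proof. by move=> p q; rewrite /polymod_scale rmorphD mulrDl. Qed.

HB.instance Definition _ := GRing.Zmodule_isLmodule.Build {mpoly K[n]} polymod
  polymod_scaleA polymod_scale1 polymod_scaleDr polymod_scaleDl.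

Lemma polymodZ p (v : polymod) : p *: v = truncX p * (v : {mpoly K[i]}).
Proof. by []. Qed.

Variable a : nat.

Definition polymod_comp (k : int) : set polymod :=
  [set v | match k - a%:Z with
           | Posz d => (v : {mpoly K[i]}) \is d.-homog
           | Negz _ => v = 0
           end].

Lemma polymod_comp0 k : polymod_comp k 0.
Proof. by rewrite /polymod_comp /=; case: (k - _) => d //; exact: dhomog0. Qed.

Lemma polymod_compB k u v :
  polymod_comp k u -> polymod_comp k v -> polymod_comp k (u - v).
Proof.
rewrite /polymod_comp /=; case: (k - _) => d; first exact: rpredB.
by move=> -> ->; rewrite subr0.
Qed.

Lemma polymod_compZ d k (p : {mpoly K[n]}) v :
  p \is d.-homog -> polymod_comp k v -> polymod_comp (d%:Z + k) (p *: v).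
Proof.
move=> /truncX_homog hp; rewrite /polymod_comp /= -addrA polymodZ.
case: (k - _) => e hv; first by rewrite -PoszD; exact: dhomogM.
by rewrite hv mulr0; case: (_ + _) => // m; exact: dhomog0.
Qed.

Lemma polymod_span (v : polymod) : exists (I : seq int) (f : int -> polymod),
  (forall k, polymod_comp k (f k)) /\ v = \sum_(k <- I) f k.
Proof.
pose f k : polymod := if k - a%:Z is Posz d then pihomog mdeg d v else 0.
exists [seq a%:Z + Posz d | d <- index_iota 0 (mmeasure mdeg v)], f; split.
  move=> k; rewrite /polymod_comp /f /=; case: (k - _) => // d; exact: pihomogP.
rewrite big_map {1}(@pihomog_partitionE _ _ mdeg _ v (leqnn _)) big_mkord.
by apply: eq_bigr => d _; rewrite /f addrAC subrr add0r.
Qed.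

Lemma polymod_direct (I : seq int) (f : int -> polymod) :
  uniq I -> (forall k, polymod_comp k (f k)) -> \sum_(k <- I) f k = 0 ->
  forall k, k \in I -> f k = 0.
Proof.
move=> uI hf h0 k kI; have := hf k; rewrite /polymod_comp /=.
case ek : (k - _) => [d|//] hd.
have := congr1 (pihomog mdeg d) h0; rewrite pihomog0 raddf_sum.
rewrite (bigD1_seq k kI uI) /= (pihomog_dE hd) big1 ?addr0 // => j ne.
have := hf j; rewrite /polymod_comp /=; case ej : (j - _) => [e|e] he.
  by apply: (pihomog_ne0 _ he); apply: contra ne => /eqP de; apply/eqP; lia.
by rewrite he pihomog0.
Qed.

Definition polymodule : gradedModule K n :=
  GradedModule polymod_comp0 polymod_compB polymod_compZ polymod_span polymod_direct.

Lemma fin_gen_polymodule : (i <= n)%N -> fin_gen polymodule.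
Proof.
move=> le; exists [:: (1 : {mpoly K[i]}) : polymod] => v.
have [p hp] := truncX_surj le v; exists (fun=> p).
by rewrite big_ord1 /= polymodZ hp mulr1.
Qed.

End Truncation.

Section Hilbert.
Variables (K : fieldType) (n : nat).

Lemma dimK0 (N : lmodType {mpoly K[n]}) (V : set N) : (forall v, V v -> v = 0) -> dimK V = 0%N.
Proof.
move=> h; rewrite -[RHS]/(size ([::] : seq N)); apply: dimK_basis; apply/is_KbasisE.
by split=> // v /h ->; exact: Kspan0.
Qed.

(** Common dimension count for shifted polynomial rings and for powers of the maximal ideal:
    preimages of the monomials of degree d form a basis. *)
Lemma dimK_homog (N : lmodType {mpoly K[n]}) (V : set N) (i d : nat)
    (f : {additive N -> {mpoly K[i.+1]}}) :
  injective f -> (forall c v, f (c%:MP *: v) = c *: f v) ->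
  (forall v, V v <-> f v \is d.-homog) ->
  (forall m, mdeg m = d -> exists v, f v = 'X_[m]) ->
  dimK V = 'C(d + i, d).
Proof.
move=> finj fZ fV fX.
pose sb := [seq s2m t | t : d.-tuple 'I_i.+1 <- enum (basis i.+1 d)].
have /choice[e he] : forall m : 'X_{1..i.+1}, exists v, mdeg m = d -> f v = 'X_[m].
  move=> m; have [/eqP /fX[v hv]|h] := boolP (mdeg m == d); first by exists v.
  by exists 0 => /eqP hm; rewrite hm in h.
have sbP m : (m \in sb) = (mdeg m == d) by rewrite basis_cover.
rewrite -size_basis -/sb -(size_map e); apply: dimK_basis; apply/is_KbasisE.
have fl c : f (lincomb (map e sb) c) = \sum_(j < size sb) c j *: 'X_[nth 0%MM sb j].
  rewrite raddf_sum (size_map e sb); apply: eq_bigr => j _ /=; rewrite fZ (nth_map 0%MM) //.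
  by rewrite he //; apply/eqP; rewrite -sbP mem_nth.
have usb : uniq sb by exact: uniq_basis.
split.
- move=> v /mapP[m]; rewrite sbP => /eqP hm ->.
  by apply/fV; rewrite he // dhomogX; apply/eqP.
- move=> c /(congr1 f); rewrite fl raddf0 (size_map e sb) => h j hj.
  move/(congr1 (mcoeff (nth 0%MM sb j))): h; rewrite mcoeff0 raddf_sum /=.
  rewrite (bigD1 (Ordinal hj)) //= mcoeffZ mcoeffX eqxx mulr1 big1 ?addr0 // => k hk.
  rewrite mcoeffZ mcoeffX nth_uniq // -[j]/(val (Ordinal hj)) val_eqE (negPf hk).
  by rewrite mulr0.
- move=> v /fV hv; exists (fun j => (f v)@_(nth 0%MM sb j)); apply: finj.
  rewrite fl {1}(mpolyE (f v)).
  transitivity (\sum_(m <- sb) (f v)@_m *: 'X_[m]); last by rewrite (big_nth 0%MM) big_mkord.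
  rewrite [RHS](bigID (mem (msupp (f v)))) /= [X in _ + X]big1 ?addr0; last first.
    by move=> m; rewrite -mcoeff_eq0 => /eqP ->; rewrite scale0r.
  rewrite -[RHS]big_filter; apply: perm_big; apply: uniq_perm.
  - exact: msupp_uniq.
  - exact: filter_uniq.
  move=> m; rewrite mem_filter; case: (boolP (m \in _)) => // hm.
  by rewrite sbP (dhomog_mf hv hm) eqxx.
Qed.

Lemma hilbert_polymodule i a (k : int) :
  hilbert_series (polymodule K n i.+1 a) k =
  if k - a%:Z is Posz d then 'C(d + i, d) else 0%N.
Proof.
rewrite /hilbert_series /= /polymod_comp.
case: (k - _) => d; last by apply: dimK0 => v.
pose f : {additive polymod K n i.+1 -> {mpoly K[i.+1]}} := idfun.
apply: (@dimK_homog _ _ _ _ f) => //; last by move=> m _; exists 'X_[m].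
by move=> c v; rewrite /f /= polymodZ truncX_C mul_mpolyC.
Qed.

End Hilbert.

(** The ideal consists of the polynomials without terms of degree below s, so from degree s on it
    contains every form. *)
Lemma hilbert_max_pow (K : fieldType) i s (k : int) :
  hilbert_series (max_pow K i.+1 s) k =
  if k is Posz d then if (s <= d)%N then 'C(d + i, d) else 0%N else 0%N.
Proof.
rewrite /hilbert_series /=; case: k => d; last first.
  by apply: dimK0 => v h; apply: pval_inj.
have [sd|ds] := leqP s d; last first.
  apply: dimK0 => v; rewrite /max_pow_comp /= => h; apply: pval_inj.
  apply/mpolyP => m; rewrite pval0 mcoeff0.
  have [lt|le] := ltnP (mdeg m) s; first exact: (max_pow_low_free (pvalP v)).
  have ne : mdeg m != d by rewrite gtn_eqF // (leq_trans ds).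
  exact: (dhomog_nemf_coeff h ne).
have padd : zmod_morphism (@pval K i.+1 s) by move=> u v; exact: pvalB.
pose f : {additive max_pow K i.+1 s -> {mpoly K[i.+1]}} :=
  HB.pack (@pval K i.+1 s) (GRing.isZmodMorphism.Build _ _ _ padd).
apply: (@dimK_homog _ _ _ _ _ d f) => //.
- exact: pval_inj.
- by move=> c v; rewrite -mul_mpolyC; exact: pvalZ.
- move=> m hm.
  have h : ('X_[m] : {mpoly K[i.+1]}^o) \in ideal_pow_pred (@max_ideal K i.+1) s.
    apply/asboolP; apply: low_free_max_pow => m' hm'; rewrite mcoeffX.
    by case: eqP => // e; move: hm'; rewrite -e hm; lia.
  by exists (IdealPow h).
Qed.

(** * Direct sums of two graded modules *)

Section DirectSum.
Variables (K : fieldType) (n : nat) (M N : gradedModule K n).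

Definition dsum_comp (k : int) : set (M * N)%type :=
  [set v | gr_comp k v.1 /\ gr_comp k v.2].

Lemma dsum_comp0 k : dsum_comp k 0.
Proof. by split; exact: gr_comp0. Qed.

Lemma dsum_compB k u v : dsum_comp k u -> dsum_comp k v -> dsum_comp k (u - v).
Proof. by move=> [h1 h2] [h3 h4]; split; exact: gr_compB. Qed.

Lemma dsum_compZ d k (p : {mpoly K[n]}) v :
  p \is d.-homog -> dsum_comp k v -> dsum_comp (d%:Z + k) (p *: v).
Proof. by move=> hp [h1 h2]; split; exact: gr_compZ. Qed.

Lemma fst_sum I (r : seq I) (f : I -> M * N) :
  (\sum_(i <- r) f i).1 = \sum_(i <- r) (f i).1.
Proof. by elim/big_rec2: _ => // i u v _ <-. Qed.

Lemma snd_sum I (r : seq I) (f : I -> M * N) :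
  (\sum_(i <- r) f i).2 = \sum_(i <- r) (f i).2.
Proof. by elim/big_rec2: _ => // i u v _ <-. Qed.

Lemma dsum_span v : exists (I : seq int) (f : int -> M * N),
  (forall k, dsum_comp k (f k)) /\ v = \sum_(k <- I) f k.
Proof.
have [h1 [I1 [u1 z1 e1]]] := gprojP v.1; have [h2 [I2 [u2 z2 e2]]] := gprojP v.2.
exists (undup (I1 ++ I2)), (fun k => (gproj k v.1, gproj k v.2)); split=> //.
rewrite [LHS]surjective_pairing [RHS]surjective_pairing fst_sum snd_sum /=.
congr (_, _).
  rewrite {1}e1; apply/esym/sum_extend => //; first exact: undup_uniq.
  by move=> k hk; rewrite mem_undup mem_cat hk.
rewrite {1}e2; apply/esym/sum_extend => //; first exact: undup_uniq.
by move=> k hk; rewrite mem_undup mem_cat hk orbT.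
Qed.

Lemma dsum_direct (I : seq int) (f : int -> M * N) :
  uniq I -> (forall k, dsum_comp k (f k)) -> \sum_(k <- I) f k = 0 ->
  forall k, k \in I -> f k = 0.
Proof.
move=> uI hf h0 k kI; rewrite [LHS]surjective_pairing; congr (_, _).
  apply: (@gr_direct _ _ M I (fun k => (f k).1)) => // [j|].
    by case: (hf j).
  by rewrite -fst_sum h0.
apply: (@gr_direct _ _ N I (fun k => (f k).2)) => // [j|].
  by case: (hf j).
by rewrite -snd_sum h0.
Qed.

Definition dsum : gradedModule K n :=
  GradedModule dsum_comp0 dsum_compB dsum_compZ dsum_span dsum_direct.

Lemma fin_gen_dsum : fin_gen M -> fin_gen N -> fin_gen dsum.
Proof.
move=> [g hg] [h hh].
exists ([seq (x, 0) | x <- g] ++ [seq (0, y) | y <- h]) => v.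
have [c ec] := hg v.1; have [d ed] := hh v.2.
exists (fun j => if (j < size g)%N then c j else d (j - size g)%N).
rewrite [LHS]surjective_pairing [RHS]surjective_pairing fst_sum snd_sum /=.
rewrite size_cat !size_map !big_split_ord /=; congr (_, _).
  rewrite [X in _ + X]big1 ?addr0 => [|j _]; last first.
    by rewrite nth_cat size_map ltnNge leq_addr /= addKn (nth_map 0) // scaler0.
  rewrite ec; apply: eq_bigr => j _.
  by rewrite ltn_ord nth_cat size_map ltn_ord (nth_map 0).
rewrite [X in X + _]big1 ?add0r => [|j _]; last first.
  by rewrite nth_cat size_map ltn_ord (nth_map 0) // scaler0.
rewrite ed; apply: eq_bigr => j _.
by rewrite nth_cat size_map ltnNge leq_addr /= addKn (nth_map 0).
Qed.

Lemma hilbert_dsum k : fin_gen M -> fin_gen N ->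
  hilbert_series dsum k = (hilbert_series M k + hilbert_series N k)%N.
Proof.
move=> fM fN.
have [b szb /is_KbasisE[bV bfree bspan]] := ex_gr_basis k fM.
have [b' szb' /is_KbasisE[bV' bfree' bspan']] := ex_gr_basis k fN.
pose B : seq dsum := [seq (x, 0) | x <- b] ++ [seq (0, y) | y <- b'].
have lB c : lincomb B c = (lincomb b c, lincomb b' (fun j => c (size b + j)%N)).
  rewrite [LHS]surjective_pairing; congr (_, _).
    rewrite /lincomb fst_sum size_cat !size_map big_split_ord /=.
    rewrite [X in _ + X]big1 ?addr0 => [|j _].
      by apply: eq_bigr => j _; rewrite nth_cat size_map ltn_ord (nth_map 0).
    by rewrite nth_cat size_map ltnNge leq_addr /= addKn (nth_map 0) // scaler0.
  rewrite /lincomb snd_sum size_cat !size_map big_split_ord /=.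
  rewrite [X in X + _]big1 ?add0r => [|j _].
    by apply: eq_bigr => j _; rewrite nth_cat size_map ltnNge leq_addr /= addKn (nth_map 0).
  by rewrite nth_cat size_map ltn_ord (nth_map 0) // scaler0.
have szB : size B = (size b + size b')%N by rewrite size_cat !size_map.
rewrite -szb -szb' -szB; apply: dimK_basis; apply/is_KbasisE; split.
- move=> v; rewrite mem_cat => /orP[] /mapP[x hx ->]; split=> /=.
  + exact: bV.
  + exact: gr_comp0.
  + exact: gr_comp0.
  + exact: bV'.
- move=> c; rewrite lB => -[/bfree h1 /bfree' h2] j; rewrite szB => hj.
  have [/h1//|le] := ltnP j (size b).
  by rewrite -(subnKC le); apply: h2; rewrite ltn_subLR.
- move=> [u w] [/= /bspan[c ->] /bspan'[d ->]].
  exists (fun j => if (j < size b)%N then c j else d (j - size b)%N).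
  rewrite lB; congr (_, _); apply: eq_lincomb => j hj; first by rewrite hj.
  by rewrite ltnNge leq_addr addKn.
Qed.

Lemma seq_submod_dsum xs (v : dsum) :
  seq_submod xs v <-> seq_submod xs v.1 /\ seq_submod xs v.2.
Proof.
split=> [[u ->]|[[u e1] [w e2]]].
  by rewrite fst_sum snd_sum; split; [exists (fun j => (u j).1) | exists (fun j => (u j).2)].
exists (fun j => (u j, w j)).
by rewrite [LHS]surjective_pairing [RHS]surjective_pairing fst_sum snd_sum e1 e2.
Qed.

Lemma regular_seq_dsum xs : regular_seq M xs -> regular_seq N xs -> regular_seq dsum xs.
Proof.
move=> [hM [v hv]] [hN _]; split; last first.
  by exists (v, 0) => /seq_submod_dsum[].
move=> i hi w /seq_submod_dsum[h1 h2]; apply/seq_submod_dsum; split.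
  exact: hM h1.
exact: hN h2.
Qed.

End DirectSum.

(** * Variables as regular sequences on shifted polynomial rings *)

Section RegularPolymodule.
Variables (K : fieldType) (n : nat).

(* Junk value 0 beyond the last variable. *)
Definition Xvar (j : nat) : {mpoly K[n]} :=
  if insub j : option 'I_n is Some l then 'X_l else 0.

Lemma max_ideal_Xvar j : max_ideal (Xvar j).
Proof.
rewrite /Xvar; case: insub => [l|]; last exact: ideal_gen0.
by apply: ideal_gen_sub; exists l.
Qed.

Lemma seq_submod_mem (N : lmodType {mpoly K[n]}) xs x (v : N) :
  x \in xs -> seq_submod xs (x *: v).
Proof.
elim: xs => [//|y xs IH]; rewrite inE seq_submod_cons => /predU1P[->|/IH h].
  by apply: addsm_subl; [exact: submodule_seq_submod | exists v].
by apply: addsm_subr h; exact: submodule_scalesm.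
Qed.

Lemma truncX_Xvar i j (hj : (j < i)%N) : (i <= n)%N ->
  truncX i (Xvar j) = 'X_(Ordinal hj).
Proof.
move=> le; rewrite /Xvar; case: insubP => [l _ el|]; last by rewrite (leq_trans hj).
rewrite truncX_X; case: insubP => [l' _ el'|]; last by rewrite el hj.
by rewrite (_ : l' = Ordinal hj) //; apply: val_inj; rewrite /= -el -el'.
Qed.

Lemma mcoeff_mulX i (l : 'I_i) (v : {mpoly K[i]}) (m : 'X_{1..i}) :
  m l = 0%N -> ('X_l * v)@_m = 0.
Proof.
move=> ml; apply: memN_msupp_eq0; rewrite mulrC.
rewrite (perm_mem (msuppMX _ _)); apply/mapP => -[m' _ e].
by move/mnmP/(_ l): e; rewrite ml mnmDE mnm1E eqxx.
Qed.

(** The submodule is a monomial ideal, so membership is decided term by term. *)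
Lemma seq_submod_polymod i j (v : polymod K n i) : (j <= i)%N -> (i <= n)%N ->
  seq_submod [seq Xvar l | l <- iota 0 j] v <->
  (forall m : 'X_{1..i}, (forall l : 'I_i, (l < j)%N -> m l = 0%N) -> (v : {mpoly K[i]})@_m = 0).
Proof.
move=> ji le; split=> [[u ->] m hm|h].
  transitivity (\sum_(l < size [seq Xvar l | l <- iota 0 j])
      (truncX i [seq Xvar l | l <- iota 0 j]`_l * u l)@_m).
    exact: (raddf_sum (@mcoeff i K m)).
  rewrite size_map size_iota; apply: big1 => l _ /=.
  rewrite (nth_map 0%N) ?size_iota // nth_iota // add0n.
  have hl : (l < i)%N by exact: leq_trans ji.
  by rewrite (truncX_Xvar hl) //; apply: mcoeff_mulX; apply: hm; exact: (ltn_ord l).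
rewrite (mpolyE v); apply: (@submodule_sum _ (polymod K n i)) => [|m _].
  exact: submodule_seq_submod.
have [/existsP[l /andP[lj ml]]|hm] := boolP [exists l : 'I_i, (l < j)%N && (m l != 0%N)].
  have -> : (v@_m *: 'X_[m] : {mpoly K[i]}) =
            Xvar l *: (v@_m *: 'X_[m - U_(l)] : polymod K n i).
    rewrite polymodZ (truncX_Xvar (ltn_ord l)) // (_ : Ordinal _ = l); last exact: val_inj.
    by rewrite -scalerAr -mpolyXD addmC submK // lep1mP.
  by apply: seq_submod_mem; apply: map_f; rewrite mem_iota.
rewrite h ?scale0r; first by exists (fun=> 0); rewrite big1 // => l _; rewrite scaler0.
move=> l lj; apply/eqP; move: hm; rewrite negb_exists => /forallP/(_ l).
by rewrite lj negbK.
Qed.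

Lemma regular_polymodule i a d : (d <= i)%N -> (i <= n)%N ->
  regular_seq (polymodule K n i a) [seq Xvar l | l <- iota 0 d].
Proof.
move=> di le; split; last first.
  exists ((1 : {mpoly K[i]}) : polymod K n i) => hs.
  have := (seq_submod_polymod _ di le).1 hs 0%MM (fun l _ => mnm0E l).
  by rewrite mcoeff1 eqxx => /eqP; rewrite oner_eq0.
move=> j; rewrite size_map size_iota => jd v.
rewrite -map_take take_iota (minn_idPl (ltnW jd)).
rewrite (nth_map 0%N) ?size_iota // nth_iota // add0n.
have ji : (j < i)%N by exact: leq_trans di.
move=> /(seq_submod_polymod _ (ltnW ji) le) h.
apply/(seq_submod_polymod _ (ltnW ji) le) => m hm.
(* Multiplication by X_j moves the coefficient at m to m + U_j, a monomial that still avoids the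
   first j variables. *)
have := h (m + U_(Ordinal ji))%MM; rewrite polymodZ (truncX_Xvar ji) // mulrC addmC mcoeffMX.
apply=> l lj; rewrite mnmDE mnm1E hm // addn0.
by case: eqP => // e; move: lj; rewrite -e /= ltnn.
Qed.

(* The Hilbert function of K[X_0, ..., X_i](-a). *)
Definition hilb_poly (t : nat * nat) (k : int) : nat :=
  if (k - t.2%:Z)%R is Posz e then 'C(e + t.1, e) else 0%N.

Lemma ex_regular_module d (l : seq (nat * nat)) : l != [::] ->
  (forall t, t \in l -> (d <= t.1.+1 <= n)%N) ->
  exists N : gradedModule K n, [/\ fin_gen N,
    forall k, hilbert_series N k = (\sum_(t <- l) hilb_poly t k)%N
    & regular_seq N [seq Xvar j | j <- iota 0 d]].
Proof.
case: l => [//|t l] _; elim: l t => [|t' l IH] t h.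
  have /andP[h1 h2] := h t (mem_head _ _).
  exists (polymodule K n t.1.+1 t.2); split; first exact: fin_gen_polymodule.
  - by move=> k; rewrite big_seq1 hilbert_polymodule.
  - exact: regular_polymodule.
have /andP[h1 h2] := h t (mem_head _ _).
have [|N [fN hN rN]] := IH t'; first by move=> u hu; apply: h; rewrite inE hu orbT.
have fp := @fin_gen_polymodule K n t.1.+1 t.2 h2.
exists (dsum (polymodule K n t.1.+1 t.2) N); split.
- exact: fin_gen_dsum.
- by move=> k; rewrite hilbert_dsum // hN hilbert_polymodule [RHS]big_cons.
- by apply: regular_seq_dsum => //; exact: regular_polymodule.
Qed.

End RegularPolymodule.

(** * Hilbert depth *)

Section FreeDecomposition.
Variables d n : nat.

(** Hilbert functions of finite direct sums of rings K[X_1, ..., X_i](-a) with d <= i <= n. An entry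
    of the list is (i - 1, a), which keeps i positive. *)
Definition decomposable (h : nat -> nat) := exists l : seq (nat * nat),
  (forall t, t \in l -> (d <= t.1.+1 <= n)%N) /\
  forall k, h k = (\sum_(t <- l) scnt t.1.+1 k t.2)%N.

Lemma eq_decomposable h h' : h =1 h' -> decomposable h -> decomposable h'.
Proof. by move=> e [l [hl el]]; exists l; split=> // k; rewrite -e. Qed.

Lemma decomposable0 : decomposable (fun=> 0%N).
Proof. by exists [::]; split=> // k; rewrite big_nil. Qed.

Lemma decomposableD h h' :
  decomposable h -> decomposable h' -> decomposable (fun k => h k + h' k)%N.
Proof.
move=> [l [hl el]] [l' [hl' el']]; exists (l ++ l'); split.
  by move=> t; rewrite mem_cat => /orP[/hl|/hl'].
by move=> k; rewrite big_cat el el'.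
Qed.

Lemma decomposableM c h : decomposable h -> decomposable (fun k => c * h k)%N.
Proof.
move=> hh; elim: c => [|c IH]; first exact: eq_decomposable decomposable0.
by apply: eq_decomposable (decomposableD hh IH) => k; rewrite mulSn.
Qed.

Lemma decomposable_sum r (h : 'I_r -> nat -> nat) : (forall i, decomposable (h i)) ->
  decomposable (fun k => \sum_(i < r) h i k)%N.
Proof.
elim: r h => [|r IH] h hh.
  by apply: eq_decomposable decomposable0 => k; rewrite big_ord0.
apply: eq_decomposable (decomposableD (hh ord0) (IH _ (fun i => hh (lift ord0 i)))).
by move=> k; rewrite big_ord_recl.
Qed.

Lemma decomposable_scnt i a : (d <= i.+1 <= n)%N -> decomposable (scnt i.+1 ^~ a).
Proof.
move=> hi; exists [:: (i, a)]; split=> [t|k]; last by rewrite big_seq1.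
by rewrite inE => /eqP ->.
Qed.

Lemma decomposable_shift h : decomposable h ->
  decomposable (fun k => if k is k'.+1 then h k' else 0%N).
Proof.
move=> [l [hl el]]; exists [seq (t.1, t.2.+1) | t <- l]; split.
  by move=> _ /mapP[t /hl ht ->].
by case=> [|k]; rewrite big_map; [rewrite big1 | rewrite el].
Qed.

End FreeDecomposition.

(** The recursion [gcntSS] ends either at D = 0, with a full polynomial ring in at least q + 1
    variables, or at m = 0 < D, with zero. *)
Lemma decomposable_gcnt q n m D : (m + q.+1 <= n)%N ->
  decomposable q.+1 n (gcnt q.+1 m D).
Proof.
elim: m D => [|m IHm] D hm.
  case: D => [|D].
    apply: (@eq_decomposable _ _ (scnt q.+1 ^~ 0%N)).
      by move=> k; rewrite gcnt0 /scnt subn0.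
    by apply: decomposable_scnt; rewrite leqnn.
  apply: eq_decomposable (decomposable0 _ _) => k.
  by rewrite /gcnt big_nat big1 // => r /andP[r0 _]; rewrite cnt0n eqn0Ngt (leq_trans _ r0).
elim: D => [|D IHD].
  apply: (@eq_decomposable _ _ (scnt (m + q).+2 ^~ 0%N)).
    by move=> k; rewrite gcnt0 /scnt subn0 addSn addnS.
  by apply: decomposable_scnt; lia.
apply: (@eq_decomposable _ _ (fun k => gcnt q.+1 m D.+1 k +
  (if k is k'.+1 then gcnt q.+1 m.+1 D k' else 0))%N).
  by move=> k; rewrite gcntSS.
by apply: decomposableD; [apply: IHm; lia | exact: decomposable_shift].
Qed.

Lemma decomposable_max_pow q m t : (t.+1 * q <= m)%N ->
  decomposable q.+1 (m + q.+1) (fun k => if (t.+1 <= k)%N then cnt (m + q.+1) k else 0%N).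
Proof.
move=> h; apply: eq_decomposable => [k|]; first exact/esym/cnt_expansion.
apply: decomposableD; first by apply: decomposable_gcnt.
apply: decomposable_sum => p; apply: decomposableM; apply: decomposable_scnt; lia.
Qed.

Lemma hilb_polyE t (k : int) :
  hilb_poly t k = if k is Posz e then scnt t.1.+1 e t.2 else 0%N.
Proof.
rewrite /hilb_poly; case: t => i a /=; case: k => e; last first.
  by case ek : (_ - _) => [x|//]; lia.
rewrite /scnt /cnt addnS /=; case: leqP => h; first by rewrite subzn // addnS.
by case ek : (_ - _) => [x|//]; lia.
Qed.

Lemma ex_max_pow_module (K : fieldType) q m t : (t.+1 * q <= m)%N ->
  exists N : gradedModule K (m + q).+1,
    [/\ fin_gen N, hilbert_series N = hilbert_series (max_pow K (m + q).+1 t.+1)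
      & regular_seq N [seq Xvar K (m + q).+1 j | j <- iota 0 q.+1]].
Proof.
move=> h; have [l [hl el]] := decomposable_max_pow h; rewrite addnS in hl el.
have l0 : l != [::].
  (* An empty list would give the value 0 in degree t + 1, where the Hilbert function is
     positive. *)
  apply/eqP => e0; have := el t.+1; rewrite leqnn e0 big_nil /cnt addnS /= => /eqP.
  by rewrite -leqn0 leqNgt bin_gt0 leq_addr.
have [N [fN hN rN]] := @ex_regular_module K _ q.+1 l l0 hl.
exists N; split=> //; apply/funext => k; rewrite hN hilbert_max_pow.
rewrite (eq_bigr _ (fun u _ => hilb_polyE u k)).
case: k => e; last by rewrite big1.
by rewrite -el /cnt addnS.
Qed.

(** The dimensions in degrees s + 1 and s are binomials with quotient (i + s + 1) / (s + 1), which
    bounds the length by [regular_seq_hilbert]. *)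
Lemma regular_seq_max_pow_le (K : fieldType) i s (N : gradedModule K i.+1)
    (xs : seq {mpoly K[i.+1]}) :
  fin_gen N -> hilbert_series N = hilbert_series (max_pow K i.+1 s) ->
  (forall x, x \in xs -> max_ideal x) -> regular_seq N xs ->
  (size xs * s.+1 <= i + s.+1)%N.
Proof.
move=> fN hN hxs rN.
have h0 (k : int) : k < s -> hilbert_series N k = 0%N.
  by rewrite hN hilbert_max_pow; case: k => // e; rewrite ltz_nat => es; rewrite leqNgt es.
have := regular_seq_hilbert fN h0 hxs rN.
rewrite hN !hilbert_max_pow leqnn leqnSn => h.
have e := mul_bin_diag (s.+1 + i) s; rewrite addSn /= in e.
have B0 : (0 < 'C(s + i, s))%N by rewrite bin_gt0 leq_addr.
rewrite -(leq_pmul2r B0) addnS [(i + s)%N]addnC e.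
by rewrite mulnAC mulnC leq_mul2l.
Qed.

Lemma ceil_divE (n s : nat) :
  Num.ceil (n%:R / s.+1%:R : rat) = ((n + s) %/ s.+1)%N.
Proof.
apply: ceil_def; have s0 : 0 < s.+1%:R :> rat by rewrite ltr0n.
have h1 := divn_eq (n + s) s.+1; have h2 := ltn_pmod (n + s) (ltn0Sn s).
move: h1 h2; set d := (_ %/ _)%N; set r := (_ %% _)%N => h1 h2.
rewrite ltr_pdivlMr // ler_pdivrMr // rmorphB /= -!natrM -[_%:~R]/(d%:R).
rewrite ler_nat mulrBl mul1r ltrBlDr -natrM -natrD ltr_nat; apply/andP; split; lia.
Qed.

Theorem theorem1p2 (K : fieldType) (n s : nat) (hn : (1 <= n)%N) (hs : (1 <= s)%N) :
  is_Hdepth (max_pow K n s) `|Num.ceil (n%:R / s.+1%:R : rat)|%N.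
Proof.
case: n hn => // i _; case: s hs => // t _; rewrite ceil_divE absz_nat.
have := divn_eq (i.+1 + t.+1) t.+2; have := ltn_pmod (i.+1 + t.+1) (ltn0Sn t.+1).
(* With n = i + 1 and s = t + 1 the ceiling is q + 1; it is positive because n is. *)
case: (_ %/ _)%N => [|q] h1 h2; first lia.
(* Stated for lengths of regular sequences, the bound serves both maxima: over all competing
   modules, and in the depth of the module constructed below. *)
have upper (N : gradedModule K i.+1) e : fin_gen N ->
    hilbert_series N = hilbert_series (max_pow K i.+1 t.+1) ->
    (exists xs : seq {mpoly K[i.+1]}, [/\ size xs = e, forall x, x \in xs -> max_ideal x
      & regular_seq N xs]) -> (e <= q.+1)%N.
  move=> fN hN [xs [<- hxs rxs]].
  by have := regular_seq_max_pow_le fN hN hxs rxs; nia.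
split; last by move=> e [N [fN hN [he _]]]; exact: (upper N).
(* Here i - q = n - d for d = q + 1, and the inequality amounts to d - 1 < n / (s + 1). *)
have hm : (t.+1 * q <= i - q)%N by nia.
have := @ex_max_pow_module K q (i - q)%N t hm.
rewrite subnK; last by nia.
move=> [N [fN hN rN]]; exists N; split=> //; split; last by move=> e; exact: upper.
exists [seq Xvar K i.+1 j | j <- iota 0 q.+1]; split=> //.
  by rewrite size_map size_iota.
by move=> _ /mapP[j _ ->]; exact: max_ideal_Xvar.
Qed.
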